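(* Let $K$ be a number field, $G$ a finite group, and $V=\mathbb{A}_K^d$ with a faithful linear $G$-action. Put $X=V/G$, $\overline V=\mathbb{P}_K^d$, $\overline X=\overline V/G$, and suppose that the quotient map $\overline V\to\overline X$ is étale in codimension one. Give the anti-canonical divisor $-K_{\overline X}$ an adelic metric, and let $H$ be the associated height function on $\overline X(K)$; for each $G$-field $L$ over $K$ let $H$ also denote the induced (pulled-back) height function on $\overline V^{|L|}(K)$. Then there is an equality of (generalized) Dirichlet series $$Z_{X_{\mathrm{prim}}(K)}(s)=\frac{1}{\sharp Z(G)}\sum_{L\in G\text{-}\mathrm{Fie}(K)}Z_{V_{\mathrm{ur}}^{|L|}(K)}(s),$$ where $Z(G)$ is the center of $G$.
   Context: Extended action: the linear $G$-action on $V$ extends to $\overline V=\mathbb{P}^d_K\supset V$, with $G$ acting trivially on the additional homogeneous coordinate $z$. $G$-rings and $G$-fields: a $G$-ring over $K$ is a $K$-algebra $L$ with a $G$-action such that $\mathrm{Spec}\,L\to\mathrm{Spec}\,K$ is an étale $G$-torsor; isomorphisms are $G$-equivariant $K$-isomorphisms. A $G$-field is a $G$-ring whose underlying ring is a field. $G\text{-}\mathrm{Fie}(K)$ is the set of isomorphism classes of $G$-fields over $K$. Unramified loci: $V_{\mathrm{ur}}\subset V$ and $X_{\mathrm{ur}}\subset X$ are the unramified loci of $V\to X$ in $V$ and in $X$. $X_{\mathrm{prim}}(K)\subset X_{\mathrm{ur}}(K)$ (primitive $K$-points) is the set of $x\in X_{\mathrm{ur}}(K)$ not in the image of $(V/H)(K)$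 for any proper subgroup $H\subsetneq G$. Untwisting variety: write $V=\mathrm{Spec}\,S^\bullet\mathcal F$ with $\mathcal F$ a $d$-dimensional $K$-vector space with $G$-action. For a $G$-ring $L$ put $\Xi_L=\mathrm{Hom}_K^G(\mathcal F,L)$ ($G$-equivariant $K$-linear maps; a $K$-vector space of dimension $d$), $\Theta_L=\mathrm{Hom}_K(\Xi_L,K)$, $V^{|L|}=\mathrm{Spec}\,S^\bullet\Theta_L$ and $\overline V^{|L|}=\mathrm{Proj}\,S^\bullet(\Theta_L\oplus K z)$. The $K$-linear map $\mathcal F\to\mathrm{Hom}_K(\Xi_L,L)=\Theta_L\otimes_K L$, $f\mapsto(\xi\mapsto\xi(f))$, together with $z\mapsto z$, induces $G$-equivariant morphisms $V^{|L|}\otimes_K L\to V$ and $\overline V^{|L|}\otimes_K L\to\overline V$ ($G$ acting on the sources through $L$), and, on taking $G$-quotients, natural morphisms $V^{|L|}\to X$ and $\pi_L:\overline V^{|L|}\to\overline X$. $V^{|L|}_{\mathrm{ur}}$ is the preimage of $X_{\mathrm{ur}}$ in $V^{|L|}$. Heights: an adelic metric on a $\mathbb{Q}$-Cartier divisor $D$ on a projective $K$-variety is an adelic metric on the invertible sheaf $\mathcal O(rD)$ for some $r>0$ with $rD$ Cartier, i.e. a collection of continuous $\mathfrak p$-adic metrics $\|\cdot\|_{\mathfrak p}$ for all places $\mathfrak p$ of $K$, which for all but finitely many finite $\mathfrak p$ are defined by a common integral model over a ring of $S$-integers. The height is $H_D(x)=\left(\prod_{\mathfrak p}\|y\|_{\mathfrak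 p}^{-1}\right)^{1/r}$ for any nonzero $y$ in the fiber of $\mathcal O(rD)$ at $x$ (with normalized absolute values). Here $H=H_{-K_{\overline X}}$ on $\overline X(K)$. Since $K_{\overline V^{|L|}}=\pi_L^*K_{\overline X}$, the divisor $-K_{\overline V^{|L|}}$ gets the pulled-back metric, and $H(y)=H(\pi_L(y))$ for $y\in\overline V^{|L|}(K)$. Height zeta function: for a set $U$ of $K$-points, $Z_U(s)=\sum_{x\in U}H(x)^{-s}$. *)

(* Defs.v *)
From HB Require Import structures.
From mathcomp Require Import all_boot all_order all_algebra all_fingroup.
From mathcomp Require Import all_solvable all_field all_character.
From mathcomp Require Import mpoly complex.
From mathcomp Require Import boolp classical_sets functions cardinality fsbigop.
From mathcomp Require Import reals constructive_ereal esum exp.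

Set Implicit Arguments.
Unset Strict Implicit.
Unset Printing Implicit Defensive.

Import Order.TTheory GRing.Theory Num.Theory.

Local Open Scope classical_set_scope.
Local Open Scope ring_scope.

(******************************************************************************)
(* All rings of functions below are subrings of one fixed field, given as     *)
(* sets.  A ring morphism out of such a subring is a function on the ambient  *)
(* ring, of which only the values on the subring matter.                      *)
(******************************************************************************)

Definition rmorph_on (F C : comNzRingType) (A : set F) (u : F -> C) : Prop :=
  u 1 = 1 /\
  forall a b, A a -> A b -> u (a + b) = u a + u b /\ u (a * b) = u a * u b.

Definition prime_ideal_of (F : comNzRingType) (A Q : set F) : Prop :=
  [/\ Q `<=` A, Q 0, ~ Q 1,
      forall a b, Q a -> Q b -> Q (a + b) &
      (forall a b, A a -> Q b -> Q (a * b)) /\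
      (forall a b, A a -> A b -> Q (a * b) -> Q a \/ Q b)].

(* The infinitesimal lifting problem for A `<=` B:

       A --u--> C
       |        | q      q surjective, (ker q)^2 = 0
       B --v--> D                                                             *)

Definition lifting_problem (F : comNzRingType) (A B : set F)
    (C D : comNzRingType) (q : {rmorphism C -> D}) (u : F -> C) (v : F -> D) :=
  [/\ forall y, exists x, q x = y,
      forall x y, q x = 0 -> q y = 0 -> x * y = 0,
      rmorph_on A u, rmorph_on B v & forall a, A a -> q (u a) = v a].

Definition is_lift (F : comNzRingType) (A B : set F)
    (C D : comNzRingType) (q : {rmorphism C -> D}) (u : F -> C) (v : F -> D)
    (w : F -> C) :=
  [/\ rmorph_on B w, forall a, A a -> w a = u a & forall b, B b -> q (w b) = v b].

Definition formally_unramified (F : comNzRingType) (A B : set F) : Prop :=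
  forall (C D : comNzRingType) (q : {rmorphism C -> D}) u v,
  lifting_problem A B q u v ->
  forall w w', is_lift A B q u v w -> is_lift A B q u v w' ->
  forall b, B b -> w b = w' b.

(* The schemes to which this is applied are of finite type over a field, so   *)
(* that being etale at a point amounts to formal etaleness of local rings.    *)
Definition formally_etale (F : comNzRingType) (A B : set F) : Prop :=
  formally_unramified A B /\
  forall (C D : comNzRingType) (q : {rmorphism C -> D}) u v,
  lifting_problem A B q u v -> exists w, is_lift A B q u v w.

(******************************************************************************)
(* Places and completions of a number field                                   *)
(******************************************************************************)

Section Places.
Variables (R : realType) (K : fieldExtType rat).

(* The normalised absolute value x |-> (#k)^(- ord x) of a finite place with  *)
(* residue field k; the list s represents the elements of k.                  *)
Definition finite_place (a : K -> R) : Prop :=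
  [/\ a 0 = 0 /\ (forall x, x != 0 -> 0 < a x),
      forall x y, a (x * y) = a x * a y,
      forall x y, a (x + y) <= Num.max (a x) (a y) &
      exists (s : seq K) (pi : K),
        [/\ forall x, x \in s -> a x <= 1,
            uniq s /\ {in s &, forall x y, x != y -> a (x - y) = 1},
            forall x, a x <= 1 -> exists2 y, y \in s & a (x - y) < 1,
            a pi = (size s)%:R^-1 &
            forall x, x != 0 -> exists n : int, a x = a pi ^ n]].

Definition real_place (a : K -> R) : Prop :=
  exists sigma : {rmorphism K -> R[i]},
    forall x, complex.Im (sigma x) = 0 /\ a x = `|complex.Re (sigma x)|.

Definition complex_place (a : K -> R) : Prop :=
  exists2 sigma : {rmorphism K -> R[i]},
    exists x, complex.Im (sigma x) != 0 &
    forall x, a x = complex.Re (sigma x) ^+ 2 + complex.Im (sigma x) ^+ 2.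

(* A place is identified with its normalised absolute value. *)
Record place := Place {
  place_abs :> K -> R;
  placeP : [\/ finite_place place_abs, real_place place_abs
             | complex_place place_abs] }.

HB.instance Definition _ := gen_eqMixin place.
HB.instance Definition _ := gen_choiceMixin place.

(* The factor 2 is needed because the normalised absolute value of a complex  *)
(* place is the square of the usual one.                                      *)
Record completion (v : place) := Completion {
  cfield :> fieldType;
  cinj : {rmorphism K -> cfield};
  cabs : cfield -> R;
  cabs_inj : forall x, cabs (cinj x) = v x;
  cabs_eq0 : forall x, cabs x = 0 <-> x = 0;
  cabs_ge0 : forall x, 0 <= cabs x;
  cabsM : forall x y, cabs (x * y) = cabs x * cabs y;
  cabsD : forall x y, cabs (x + y) <= 2 * (cabs x + cabs y);
  cdense : forall (x : cfield) (e : R), 0 < e -> exists y, cabs (x - cinj y) < e;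
  ccomplete : forall u : nat -> cfield,
    (forall e : R, 0 < e -> exists N, forall m n,
       (N <= m)%N -> (N <= n)%N -> cabs (u m - u n) < e) ->
    exists l, forall e : R, 0 < e -> exists N, forall n,
       (N <= n)%N -> cabs (u n - l) < e }.

(* S is a set of places; the archimedean ones are tacitly added to it.        *)
Definition S_integer (S : set place) : set K :=
  [set x | forall v : place, finite_place v -> ~ S v -> v x <= 1].

End Places.

(******************************************************************************)
(* The quotients of V = Spec K[x_0, .., x_(d-1)] and of its compactification  *)
(* P^d = Proj K[x_0, .., x_(d-1), z].  The variable z is the last one.        *)
(******************************************************************************)

Local Notation "x %:F" := (@FracField.tofrac _ x).

Section Quotient.
Variables (K : fieldType) (gT : finGroupType) (d : nat).
Variable rG : mx_representation K [set: gT]%G d.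

Local Notation G := [set: gT]%SET.

(* The vector space F of linear forms, on which g acts by f |-> rG g *m f;    *)
(* the j-th basis vector is the coordinate x_j.                               *)
Definition lforms := 'cV[K]_d.

Definition act_poly (g : gT) (p : {mpoly K[d]}) : {mpoly K[d]} :=
  p \mPo [tuple \sum_(i < d) rG g i j *: 'X_i | j < d].

Definition funfield := {fraction {mpoly K[d]}}.

Definition cst (c : K) : funfield := (c%:MP)%:F.

(* K(V)^H = K(V / H) *)
Definition invariants (H : {set gT}) : set funfield :=
  [set f | exists a b : {mpoly K[d]}, [/\ b != 0, f = a%:F / b%:F &
     forall h, h \in H -> act_poly h a * b = a * act_poly h b]].

Definition dehomog (p : {mpoly K[d.+1]}) : {mpoly K[d]} :=
  p \mPo [tuple if unlift ord_max i is Some j then 'X_j else 1 | i < d.+1].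

(* A point of the scheme P^d is a homogeneous prime ideal not containing the  *)
(* irrelevant ideal; it lies in V when it does not contain z.                 *)
Definition ppoint (P : set {mpoly K[d.+1]}) : Prop :=
  [/\ prime_ideal_of setT P,
      forall p n, P p -> P (pihomog mdeg n p) &
      exists i, ~ P 'X_i].

Definition in_V (P : set {mpoly K[d.+1]}) : Prop := ~ P 'X_ord_max.

(* Codimension at most one, i.e. height at most one. *)
Definition codim_le1 (P : set {mpoly K[d.+1]}) : Prop :=
  forall Q, ppoint Q -> Q `<=` P -> Q = [set 0] \/ Q = P.

(* The local ring of P^d at P, inside K(V). *)
Definition localP (P : set {mpoly K[d.+1]}) : set funfield :=
  [set f | exists n a b, [/\ a \is n.-homog for mdeg, b \is n.-homog for mdeg,
     ~ P b & f = (dehomog a)%:F / (dehomog b)%:F]].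

(* The local ring of P^d / H at the image of P. *)
Definition localQ (H : {set gT}) (P : set {mpoly K[d.+1]}) : set funfield :=
  localP P `&` invariants H.

Definition etale_in_codim1 : Prop :=
  forall P, ppoint P -> codim_le1 P -> formally_etale (localQ G P) (localP P).

(* For a field E over K, an E-point of a K-scheme is a point of the scheme    *)
(* with a local morphism of K-algebras from its local ring to E.  An E-point  *)
(* of P^d / H is encoded by evaluation of rational functions, with value None *)
(* at functions not regular at the point.  [point_at H iota x P] says that    *)
(* the underlying scheme point of x is the image of P.                        *)
Definition point_at (H : {set gT}) (E : fieldType) (iota : {rmorphism K -> E})
    (x : funfield -> option E) (P : set {mpoly K[d.+1]}) : Prop :=
  [/\ forall f, localQ H P f <-> exists c, x f = Some c,
      forall c, x (cst c) = Some (iota c),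
      forall f g a b, x f = Some a -> x g = Some b ->
        x (f + g) = Some (a + b) /\ x (f * g) = Some (a * b) &
      forall f, localQ H P f -> ~ localQ H P f^-1 -> x f = Some 0].

Definition barX_points (H : {set gT}) (E : fieldType)
    (iota : {rmorphism K -> E}) : set (funfield -> option E) :=
  [set x | exists2 P, ppoint P & point_at H iota x P].

Definition X_points (H : {set gT}) (E : fieldType)
    (iota : {rmorphism K -> E}) : set (funfield -> option E) :=
  [set x | exists P, [/\ ppoint P, in_V P & point_at H iota x P]].

(* X_ur(K), where X = V / G and X_ur is the set of points of X over which     *)
(* V -> X is unramified.                                                      *)
Definition X_ur : set (funfield -> option K) :=
  [set x | X_points G idfun x /\
     forall P, ppoint P -> point_at G idfun x P ->
       formally_unramified (localQ G P) (localP P)].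

(* The image of x under P^d / H -> P^d / G. *)
Definition restrict_point (E : fieldType) (x : funfield -> option E) :
    funfield -> option E :=
  fun f => if `[< invariants G f >] then x f else None.

Definition X_prim : set (funfield -> option K) :=
  [set x | X_ur x /\
     forall H : {group gT}, H \proper G ->
       ~ exists2 y, X_points H idfun y & x = restrict_point y].

(******************************************************************************)
(* Pluri-anticanonical sheaves of P^d / G                                     *)
(******************************************************************************)

Definition pderiv (i : 'I_d) (f : funfield) : funfield :=
  let a := \n_(generic_quotient.repr f) in let b := \d_(generic_quotient.repr f) in
  (a^`M(i) * b - a * b^`M(i))%:F / (b ^+ 2)%:F.

(* df_0 /\ .. /\ df_(d-1) = jacobian f * dx_0 /\ .. /\ dx_(d-1) *)
Definition jacobian (f : 'I_d -> funfield) : funfield :=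
  \det (\matrix_(i < d, j < d) pderiv j (f i)).

(* The stalk at the image of P of O(- r K_X) on X = P^d / G.  A rational      *)
(* section of it is s * (D_0 /\ .. /\ D_(d-1))^r, where D_j is the derivation *)
(* dual to dx_j.  At a point of codimension at most one X is regular, and its *)
(* canonical sheaf is there spanned by the df_0 /\ .. /\ df_(d-1) with f_i in *)
(* the local ring; s is regular there when its contractions with all r-fold   *)
(* products of such forms are.  X being normal, sections of O(- r K_X) are    *)
(* controlled by the points of codimension at most one.                       *)
Definition anticanonical (r : nat) (P : set {mpoly K[d.+1]}) : set funfield :=
  [set s | forall Q, ppoint Q -> codim_le1 Q -> Q `<=` P ->
     forall f : 'I_r -> 'I_d -> funfield,
       (forall k i, localQ G Q (f k i)) ->
       localQ G Q (s * \prod_(k < r) jacobian (f k))].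

Definition generates (r : nat) (P : set {mpoly K[d.+1]}) (s : funfield) :=
  s != 0 /\ forall t, anticanonical r P t <-> localQ G P (t / s).

(* - r K_X is a Cartier divisor. *)
Definition anticanonical_Cartier (r : nat) : Prop :=
  forall P, ppoint P -> exists s, generates r P s.

(******************************************************************************)
(* Projective integral models over a subring O of K                           *)
(******************************************************************************)

(* The O-subalgebra of K(V) generated by u_0, .., u_(n-1). *)
Definition gen_algebra (O : set K) n (u : 'I_n -> funfield) : set funfield :=
  [set f | exists2 p : {mpoly K[n]}, forall m, O p@_m & f = mmap cst u p].

Definition span (A : set funfield) (s : seq funfield) : set funfield :=
  [set f | exists2 a : nat -> funfield, forall i, A (a i) &
     f = \sum_(i < size s) a i * s`_i].

(* t_0, .., t_N are the homogeneous coordinates of a closed immersion of      *)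
(* X = P^d / G into P^N_K: it is everywhere defined, and the local rings of X *)
(* are localisations of the K[t_i / t_j].                                     *)
Definition in_chart N (t : 'I_N -> funfield) (P : set {mpoly K[d.+1]}) j :=
  forall i, localQ G P (t i / t j).

Definition closed_immersion N (t : 'I_N -> funfield) : Prop :=
  [/\ forall j, t j != 0,
      forall P, ppoint P -> exists j, in_chart t P j &
      forall P j, ppoint P -> in_chart t P j ->
      forall f, localQ G P f -> exists a b,
        [/\ gen_algebra setT (fun i => t i / t j) a,
            gen_algebra setT (fun i => t i / t j) b,
            localQ G P b^-1 & b != 0 /\ f = a / b]].

(* The model of X is the closure of X in P^N_O, with affine charts            *)
(* Spec O[t_i / t_j], and M j is the module of sections over the j-th chart   *)
(* of an invertible sheaf on it extending O(- r K_X).                         *)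
Definition integral_model (O : set K) (r N : nat) (t : 'I_N -> funfield)
    (M : 'I_N -> set funfield) : Prop :=
  let A j := gen_algebra O (fun i => t i / t j) in
  [/\ closed_immersion t,
      forall j, exists s, M j = span (A j) s,
      forall i j s, M i s -> exists n, M j (s * (t i / t j) ^+ n),
      forall j Q, prime_ideal_of (A j) Q -> exists2 s, M j s &
        forall m, M j m -> exists a b,
          [/\ A j a, A j b, ~ Q b & b * m = a * s] &
      forall j P, ppoint P -> in_chart t P j ->
        M j `<=` anticanonical r P /\ exists2 s, M j s & generates r P s].

End Quotient.

(******************************************************************************)
(* Adelic metrics and heights                                                 *)
(******************************************************************************)

Section Heights.
Variables (R : realType) (K : fieldExtType rat) (gT : finGroupType) (d : nat).
Variable rG : mx_representation K [set: gT]%G d.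
Variable Kv : forall v : place R K, completion v.

Local Notation G := [set: gT]%SET.
Local Notation FV := (funfield K d).

(* N x s is the norm of the value at x of a germ s at x of a section of       *)
(* O(- r K_X).  Open sets of X(K_v) are generated by the conditions           *)
(* |f(x) - c|_v < delta, f a rational function (required to be regular at x). *)
Definition padic_metric (r : nat) (v : place R K)
    (N : (FV -> option (Kv v)) -> FV -> R) : Prop :=
  [/\ forall x P s f c, ppoint P -> point_at rG G (cinj (Kv v)) x P ->
        anticanonical rG r P s -> x f = Some c ->
        N x (f * s) = cabs c * N x s,
      forall x P s, ppoint P -> point_at rG G (cinj (Kv v)) x P ->
        generates rG r P s -> 0 < N x s &
      forall x P s (e : R), ppoint P -> point_at rG G (cinj (Kv v)) x P ->
        anticanonical rG r P s -> 0 < e ->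
        exists (fs : seq FV) (delta : R),
          [/\ 0 < delta, forall f, f \in fs -> localQ rG G P f &
          forall x' P', ppoint P' -> point_at rG G (cinj (Kv v)) x' P' ->
            anticanonical rG r P' s ->
            (forall f, f \in fs -> exists c c',
               [/\ x f = Some c, x' f = Some c' & cabs (c' - c) < delta]) ->
            `|N x' s - N x s| < e]].

(* The unit ball of the model metric at x is the image of the sections of the *)
(* model on a chart through which the integral point extending x factors.     *)
Definition model_metric (r : nat) (v : place R K)
    (N : (FV -> option (Kv v)) -> FV -> R) n (t : 'I_n -> FV)
    (M : 'I_n -> set FV) : Prop :=
  forall x, barX_points rG G (cinj (Kv v)) x ->
  forall j, (forall i, exists2 c, x (t i / t j) = Some c & cabs c <= 1) ->
    (forall s, M j s -> N x s <= 1) /\ exists2 s, M j s & N x s = 1.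

(* An adelic metric on the Q-Cartier divisor - K_X, X = P^d / G *)
Record adelic_metric := AdelicMetric {
  am_r : nat;
  am_r_gt0 : (0 < am_r)%N;
  am_Cartier : anticanonical_Cartier rG am_r;
  am_norm : forall v : place R K, (FV -> option (Kv v)) -> FV -> R;
  am_metric : forall v, padic_metric am_r (@am_norm v);
  am_model : exists S : set (place R K), finite_set S /\
    exists n (t : 'I_n -> FV) (M : 'I_n -> set FV),
      integral_model rG (S_integer S) am_r t M /\
      forall v : place R K, finite_place v -> ~ S v ->
        model_metric am_r (@am_norm v) t M }.

Variable m : adelic_metric.

(* The image of x in X(K_v). *)
Definition at_place (v : place R K) (x : FV -> option K) : FV -> option (Kv v) :=
  fun f => omap (cinj (Kv v)) (x f).

(* A nonzero element of the fibre at x is the value of a generating germ s.   *)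
Definition height (x : FV -> option K) : R :=
  let s := xget 0 [set s | exists P, [/\ ppoint P, point_at rG G idfun x P &
                                         generates rG (am_r m) P s]] in
  (\big[*%R/1]_(v \in [set: place R K]) (am_norm m (at_place v x) s)^-1)
    `^ ((am_r m)%:R^-1).

End Heights.

(******************************************************************************)
(* G-fields and untwisting                                                    *)
(******************************************************************************)

(* For a basis b of L over K, L (x)_K L is free with basis the 1 (x) b_j as a *)
(* left L-module; [torsor] says that the morphism of algebras                 *)
(*   L (x)_K L -> L^G,  a (x) b |-> (a * g(b))_g                              *)
(* is bijective, i.e. that G x Spec L -> Spec L x Spec L is an isomorphism.   *)
Definition torsor (K : fieldType) (gT : finGroupType) (L : fieldExtType K)
    (act : gT -> 'AEnd(L)) : Prop :=
  bijective (fun a : {ffun 'I_(\dim {:L}) -> L} =>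
    [ffun g : gT => \sum_(j < \dim {:L}) a j * act g (vbasis {:L})`_j]).

Record Gfield (K : fieldType) (gT : finGroupType) := GField {
  gf_field :> fieldExtType K;
  gf_act : gT -> 'AEnd(gf_field);
  gf_act1 : forall x, gf_act 1%g x = x;
  gf_actM : forall g h x, gf_act (g * h)%g x = gf_act g (gf_act h x);
  gf_etale : separable 1 {: gf_field};
  gf_torsor : torsor gf_act }.

Definition Gfield_iso (K : fieldType) (gT : finGroupType) (L L' : Gfield K gT) :=
  exists2 phi : 'AHom(L, L'), bijective phi &
    forall g x, phi (gf_act L g x) = gf_act L' g (phi x).

(* The family L enumerates the set G-Fie(K) of isomorphism classes of         *)
(* G-fields, through one representative of each class.                        *)
Definition enumerates_GFie (K : fieldType) (gT : finGroupType) (I : Type)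
    (L : I -> Gfield K gT) : Prop :=
  forall M : Gfield K gT, exists! i, Gfield_iso M (L i).

Section Untwisting.
Variables (K : fieldType) (gT : finGroupType) (d : nat).
Variable rG : mx_representation K [set: gT]%G d.
Variable L : Gfield K gT.

Local Notation G := [set: gT]%SET.

(* Xi_L, the space of equivariant linear maps from the linear forms to L *)
Definition Xi : {vspace 'Hom(lforms K d, L)} :=
  (\bigcap_(g : gT) lker (linfun (fun xi : 'Hom(lforms K d, L) =>
     (gf_act L g \o xi)%VF - (xi \o linfun (mulmx (rG g)))%VF)))%VS.

Definition Theta := 'Hom(subvs_of Xi, K^o).

(* K-points of V^|L| = Spec S Theta_L are the linear maps Theta_L -> K.       *)
Definition untwist_points := 'Hom(Theta, K^o).

(* The j-th coordinate form on Xi_L in the basis vbasis Xi *)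
Definition theta (j : 'I_(\dim Xi)) : Theta :=
  linfun (fun xi : subvs_of Xi => coord (vbasis Xi) j (vsval xi) : K^o).

(* The composite F -> Hom(Xi_L, L) = Theta_L (x) L -> L, the latter induced   *)
(* by y; the map xi |-> xi f is the sum of the theta_j (x) xi_j(f).           *)
Definition untwist (y : untwist_points) (f : lforms K d) : L :=
  \sum_(j < \dim Xi) (y (theta j) : K) *: ((vbasis Xi)`_j : 'Hom(_, L)) f.

(* Homogeneous coordinates of the L-point of P^d given by the K-point (y : c) *)
(* of the compactification Proj S (Theta_L + K z) of V^|L|.                   *)
Definition untwist_coords (yc : untwist_points * K) (i : 'I_d.+1) : L :=
  if unlift ord_max i is Some j then untwist yc.1 (delta_mx j 0) else yc.2%:A.

(* The morphism pi_L on K-points *)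
Definition pi_L (yc : untwist_points * K) : funfield K d -> option K :=
  let ev (p : {mpoly K[d.+1]}) := mmap (in_alg L) (untwist_coords yc) p in
  fun f => xget None [set o | exists c n a b,
    [/\ o = Some c, a \is n.-homog for mdeg /\ b \is n.-homog for mdeg,
        invariants rG G f /\ f = (dehomog a)%:F / (dehomog b)%:F,
        ev b != 0 & c%:A = ev a / ev b]].

(* V^|L|_ur(K); V^|L| is the locus c = 1 of its compactification. *)
Definition V_ur : set untwist_points := [set y | X_ur rG (pi_L (y, 1))].

End Untwisting.

Arguments V_ur {K gT d} rG L _.

(******************************************************************************)
(* Generalized Dirichlet series                                               *)
(******************************************************************************)

(* The coefficient of h^(-s), and the value at a real number s, of the series *)
(* of all H(x)^(-s), x in U.                                                  *)
Definition dirichlet_coef (R : realType) (T : choiceType) (H : T -> R)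
    (U : set T) (h : R) : \bar R :=
  \esum_(x in U `&` [set x | H x = h]) 1%E.

Definition dirichlet_value (R : realType) (T : choiceType) (H : T -> R)
    (U : set T) (s : R) : \bar R :=
  \esum_(x in U) (H x `^ (- s))%:E.

(* Main.v *)
Require Import Defs.
From HB Require Import structures.
From mathcomp Require Import all_boot all_order all_algebra all_fingroup.
From mathcomp Require Import all_solvable all_field all_character.
From mathcomp Require Import mpoly complex.
From mathcomp Require Import boolp classical_sets functions cardinality fsbigop.
From mathcomp Require Import reals constructive_ereal esum exp.
From mathcomp Require Import ring.

Set Implicit Arguments.
Unset Strict Implicit.
Unset Printing Implicit Defensive.

Import Order.TTheory GRing.Theory Num.Theory.

Local Open Scope classical_set_scope.
Local Open Scope ring_scope.

(** A K-point of the untwisted space of a G-field L amounts to a G-equivariant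
    homomorphism of K-algebras phi : K[V] -> L, and its image under pi_L is
    the point of X at which an invariant rational function takes the value
    that phi gives it ([pi_L_encodes]).  All heights being heights on X, the
    theorem follows from a statement about points: the points of the
    unramified loci map to primitive points, and each primitive point comes
    from exactly one G-field up to isomorphism, and for this one from exactly
    as many homomorphisms phi as the centre of G has elements.  Both equalities
    then result from summing along the fibres ([esum_fibres]).

    Unramifiedness is used through the triviality of inertia groups
    ([inertia_trivial]).  Let g fix a homomorphism phi from K[V] to a field E.
    Moving phi infinitesimally in the directions v and g v gives two lifts of
    phi to the dual numbers over E which agree on G-invariant functions.  If V
    is unramified over X at phi they coincide, so g v = v for all v, and g = 1
    by faithfulness.  As K is infinite, some linear form l then takes pairwise
    distinct values phi (g l) ([free_orbit_form]).  The polynomial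
    prod_g (T - g l) has invariant coefficients; at a K-point of X it becomes
    a polynomial s over K with the phi (g l) as simple roots.

    If phi : K[V] -> L is equivariant, G permutes these roots transitively and
    s is irreducible.  A lift of the point to V / H would make
    prod_(h in H) (T - h l) a factor of s over K, so H = G: the point is
    primitive ([equivariant_X_prim]).

    Conversely let x be a primitive point and phi : K[V] -> E the map to the
    residue field of a point of V above x.  By Lagrange interpolation, phi(l)
    generates the residue field over K, so that this field is finite over K
    ([finite_residue_field]).  Functions invariant under the decomposition
    group D have values in K ([decomposition_invariants_rat]): x lifts to
    V / D.  Hence D = G, so G acts on the residue field and turns it into a
    G-field ([X_prim_from_Gfield]).

    Finally, two homomorphisms to a field which agree on invariants differ by
    an element g of G ([lies_over_conjugate]).  It follows that the G-field of
    x is unique ([equivariant_unique]), and since g commutes with G when both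
    homomorphisms are equivariant, the homomorphisms above x form an orbit
    under the centre of G ([fibre_center]). *)

(** * The action on polynomials and rational functions *)

Local Notation "x %:F" := (@FracField.tofrac _ x).

Lemma mpoly_closed_ind (K : nzRingType) n (Q : {mpoly K[n]} -> Prop) :
  (forall c, Q c%:MP) -> (forall i, Q 'X_i) ->
  (forall p q, Q p -> Q q -> Q (p + q)) ->
  (forall p q, Q p -> Q q -> Q (p * q)) -> forall p, Q p.
Proof.
move=> QC QX QD QM p; rewrite (mpolyE p).
elim/big_ind: _ => //= [|m _]; first by rewrite -mpolyC0.
rewrite -mul_mpolyC; apply: (QM) => //; rewrite mpolyXE_id.
elim/big_ind: _ => //= [|i _]; first by rewrite -mpolyC1.
by elim: (m i) => [|k IH]; [rewrite expr0 -mpolyC1|rewrite exprS; apply: QM].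
Qed.

Lemma mpoly_rmorph_ext (K : fieldType) n (C : comNzRingType)
    (f g : {rmorphism {mpoly K[n]} -> C}) :
  (forall c, f c%:MP = g c%:MP) -> (forall i, f 'X_i = g 'X_i) -> f =1 g.
Proof.
move=> hc hx; apply: mpoly_closed_ind => // p q hp hq; first by rewrite !rmorphD hp hq.
by rewrite !rmorphM hp hq.
Qed.

Lemma tofrac_inj (D : idomainType) : injective (@FracField.tofrac D).
Proof. by move=> a b /eqP; rewrite tofrac_eq => /eqP. Qed.

Lemma frac_eqP (D : idomainType) (a b a' b' : D) : b != 0 -> b' != 0 ->
  a%:F / b%:F = a'%:F / b'%:F <-> a * b' = a' * b.
Proof.
move=> b0 b'0; split=> [/eqP|E].
  by rewrite eqr_div ?tofrac_eq0 // -!rmorphM => /eqP/tofrac_inj.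
by apply/eqP; rewrite eqr_div ?tofrac_eq0 // -!rmorphM E.
Qed.

Section Action.
Variables (K : fieldType) (gT : finGroupType) (d : nat).
Variable rG : mx_representation K [set: gT]%G d.

Local Notation A := {mpoly K[d]}.
Local Notation act := (act_poly rG).

HB.instance Definition _ g := GRing.RMorphism.copy (act g)
  (comp_mpoly [tuple \sum_(i < d) rG g i j *: 'X_i | j < d]).

Lemma act_polyC g c : act g c%:MP = c%:MP.
Proof. exact: comp_mpolyC. Qed.

Lemma act_polyX g j : act g 'X_j = \sum_(i < d) rG g i j *: 'X_i.
Proof. by rewrite /act_poly comp_mpolyXU -tnth_nth tnth_mktuple. Qed.

Lemma act_polyZ g c p : act g (c *: p) = c *: act g p.
Proof. exact: comp_mpolyZ. Qed.

Lemma act_polyM g h p : act (g * h)%g p = act g (act h p).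
Proof.
apply: (@mpoly_rmorph_ext _ _ _ (act (g * h)%g) (act g \o act h)) => [c|j].
  by rewrite /= !act_polyC.
rewrite /= !act_polyX repr_mxM ?inE // (rmorph_sum (act g)) /=.
under [RHS]eq_bigr => i _.
  rewrite act_polyZ act_polyX scaler_sumr; under eq_bigr do rewrite scalerA; over.
rewrite exchange_big; apply: eq_bigr => i _; rewrite mxE scaler_suml.
by apply: eq_bigr => k _; rewrite mulrC.
Qed.

Lemma act_poly1 p : act 1%g p = p.
Proof.
apply: (@mpoly_rmorph_ext _ _ _ (act 1%g) idfun) => [c|j]; first exact: act_polyC.
rewrite /= act_polyX repr_mx1 (bigD1 j) //= mxE eqxx scale1r big1 ?addr0 // => i ij.
by rewrite mxE (negPf ij) scale0r.
Qed.

Lemma act_polyK g : cancel (act g) (act g^-1%g).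
Proof. by move=> p; rewrite -act_polyM mulVg act_poly1. Qed.

Lemma act_polyKV g : cancel (act g^-1%g) (act g).
Proof. by move=> p; rewrite -act_polyM mulgV act_poly1. Qed.

Lemma act_poly_eq0 g p : (act g p == 0) = (p == 0).
Proof. by rewrite -[RHS](inj_eq (can_inj (act_polyK g))) rmorph0. Qed.

Definition invpoly (H : {set gT}) (p : A) := forall h, h \in H -> act h p = p.

Lemma invpolyP H p : invariants rG H p%:F <-> invpoly H p.
Proof.
split=> [[a [b [b0 E inv]]] h hH|inv]; last first.
  exists p, 1; split; rewrite ?oner_eq0 ?rmorph1 ?divr1 // => h hH.
  by rewrite rmorph1 !mulr1 inv.
have {}E : a = p * b.
  apply: (@tofrac_inj _); rewrite rmorphM /= E divfK // tofrac_eq0 //.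
apply: (mulIf b0); apply: (mulIf (_ : act h b != 0)); first by rewrite act_poly_eq0.
by rewrite mulrAC -rmorphM -E (inv h hH) E.
Qed.

(** [invariants] asks for invariance of one representing fraction; it then
    holds for all of them. *)
Lemma invariants_div H (a b : A) : b != 0 ->
  invariants rG H (a%:F / b%:F) <-> forall h, h \in H -> act h a * b = a * act h b.
Proof.
move=> b0; split=> [[a' [b' [b'0 E inv]]] h hH|inv]; last by exists a, b.
have {}E : a * b' = a' * b.
  by apply/frac_eqP.
apply: (mulIf b'0); apply: (mulIf (_ : act h b' != 0)); first by rewrite act_poly_eq0.
have -> : act h a * b * b' * act h b' = (act h a * act h b') * (b * b') by ring.
have -> : a * act h b * b' * act h b' = (a * b') * act h b * act h b' by ring.
rewrite E -rmorphM E rmorphM /=.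
have -> : act h a' * act h b * (b * b') = (act h a' * b') * act h b * b by ring.
by rewrite inv //; ring.
Qed.

Lemma invariants_cst H c : invariants rG H (Defs.cst d c).
Proof. by apply/invpolyP => h _; rewrite act_polyC. Qed.

Lemma invariantsD H f g : invariants rG H f -> invariants rG H g -> invariants rG H (f + g).
Proof.
move=> [a [b [b0 -> ib]]] [a' [b' [b'0 -> ib']]].
exists (a * b' + a' * b), (b * b'); split; first by rewrite mulf_neq0.
  by rewrite addf_div ?tofrac_eq0 // rmorphD !rmorphM.
move=> h hH; rewrite rmorphD !rmorphM /= !mulrDl.
have -> : act h a * act h b' * (b * b') = (act h a * b) * (act h b' * b') by ring.
have -> : act h a' * act h b * (b * b') = (act h a' * b') * (act h b * b) by ring.
by rewrite ib // ib' //; ring.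
Qed.

Lemma invariantsM H f g : invariants rG H f -> invariants rG H g -> invariants rG H (f * g).
Proof.
move=> [a [b [b0 -> ib]]] [a' [b' [b'0 -> ib']]].
exists (a * a'), (b * b'); split; first by rewrite mulf_neq0.
  by rewrite !rmorphM mulf_div.
move=> h hH; rewrite !rmorphM /=.
have -> : act h a * act h a' * (b * b') = (act h a * b) * (act h a' * b') by ring.
by rewrite ib // ib' //; ring.
Qed.

Lemma invariantsV H f : invariants rG H f -> invariants rG H f^-1.
Proof.
move=> [a [b [b0 -> ib]]]; have [->|a0] := eqVneq a 0.
  rewrite rmorph0 mul0r invr0.
  by have := invariants_cst H 0; rewrite /Defs.cst mpolyC0 rmorph0.
exists b, a; split => //; first by rewrite invf_div.
by move=> h hH; rewrite mulrC -ib // mulrC.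
Qed.

Lemma invariantsS (H H' : {set gT}) f : H \subset H' -> invariants rG H' f -> invariants rG H f.
Proof.
by move=> /fintype.subsetP s [a [b [b0 E ib]]]; exists a, b; split=> // h /s; apply: ib.
Qed.

End Action.

(** * Residue fields and homogenisation *)

Local Open Scope quotient_scope.

(** Fractions are defined over rings with a function for inverses; classical
    logic provides one on any domain. *)
Lemma domain_in_field (D : comNzRingType) :
  (forall x y : D, x * y = 0 -> (x == 0) || (y == 0)) ->
  exists (E : fieldType) (f : {rmorphism D -> E}), injective f.
Proof.
move=> Dint.
pose U : pred D := fun x => `[< exists y, y * x = 1 >].
pose V (x : D) : D :=
  if pselect (exists y, y * x = 1) is left h then projT1 (cid h) else x.
have VU : {in U, left_inverse 1 V *%R}.
  by move=> x /asboolP h; rewrite /V; case: pselect => // h'; case: (cid h').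
have UP (x y : D) : y * x = 1 -> U x by move=> h; apply/asboolP; exists y.
have Vout : {in [predC U], V =1 id}.
  by move=> x /asboolP h; rewrite /V; case: pselect.
pose mu := GRing.ComNzRing_hasMulInverse.Build D VU UP Vout.
pose Du : comUnitRingType := HB.pack D mu.
pose md := GRing.ComUnitRing_isIntegral.Build Du Dint.
pose Di : idomainType := HB.pack Du md.
pose f : D -> {fraction Di} := @FracField.tofrac Di.
have fz : zmod_morphism f.
  move=> x y; change (@Algebra.add D x (- y)) with (@Algebra.add Di x (- (y : Di))).
  exact: (@tofracB Di x y).
have fm : monoid_morphism f.
  split=> [|x y]; first exact: (@tofrac1 Di).
  change (@GRing.mul D x y) with (@GRing.mul Di x y).
  exact: (@tofracM Di x y).
pose mz := GRing.isZmodMorphism.Build D {fraction Di} f fz.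
pose mm := GRing.isMonoidMorphism.Build D {fraction Di} f fm.
pose psi : {rmorphism D -> {fraction Di}} := HB.pack f mz mm.
exists {fraction Di}, psi => x y xy; apply/eqP.
by rewrite -(tofrac_eq (x : Di) y); apply/eqP.
Qed.

Lemma residue_field (B : comNzRingType) (Q : set B) : prime_ideal_of setT Q ->
  exists (E : fieldType) (psi : {rmorphism B -> E}), forall q, Q q <-> psi q = 0.
Proof.
move=> [_ Q0 Q1 QD [QM Qpr]].
pose I : B -> bool := fun q => `[< Q q >].
have hI1 : idealr_closed I.
  split; [exact/asboolP|exact/asboolP|move=> a u v /asboolP Qu /asboolP Qv].
  by apply/asboolP/QD => //; apply: QM.
have hI2 : prime_idealr_closed I.
  by move=> u v /asboolP/(Qpr _ _ Logic.I Logic.I)[h|h]; apply/orP;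
    [left|right]; apply/asboolP.
pose m1 := isIdealr.Build B I hI1.
pose m2 := isPrimeIdealrClosed.Build B I hI2.
pose II : prime_idealr B := HB.pack I m1 m2.
have [E [f finj]] := domain_in_field (@Quotient.rquot_IdomainAxiom B II).
exists E, (f \o \pi_{ideal_quot II}) => q.
have f0 : f (\pi 0) = 0 by rewrite !rmorph0.
rewrite -f0; split=> [Qq|/finj/eqP]; last first.
  by rewrite -Quotient.idealrBE subr0 => /asboolP.
by congr (f _); apply/eqP; rewrite -Quotient.idealrBE subr0; apply/asboolP.
Qed.

Section Homogeneous.
Variables (K : fieldType).

(** For f the evaluation of homogeneous coordinates and g that of the
    corresponding affine coordinates, t is the value of the coordinate z. *)
Lemma homog_scale n (C : comNzRingType) (f g : {rmorphism {mpoly K[n]} -> C}) t :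
  (forall c, f c%:MP = g c%:MP) -> (forall i, f 'X_i = t * g 'X_i) ->
  forall k a, a \is k.-homog for mdeg -> f a = t ^+ k * g a.
Proof.
move=> hc hx k a /dhomogP ha; rewrite (mpolyE a) !rmorph_sum mulr_sumr.
rewrite !big_seq; apply: eq_bigr => m /ha <- /=.
rewrite -mul_mpolyC !rmorphM hc mulrCA; congr (_ * _).
rewrite mpolyXE_id !rmorph_prod mdegE -prodrXr -big_split /=.
by apply: eq_bigr => i _; rewrite !rmorphXn hx exprMn.
Qed.

Variable d : nat.
Local Notation dehomog := (@Defs.dehomog K d).

Lemma dehomog_is_zmod_morphism : zmod_morphism dehomog.
Proof. exact: comp_mpoly_is_additive. Qed.

Lemma dehomog_is_monoid_morphism : monoid_morphism dehomog.
Proof. by split; [exact: comp_mpoly1|exact: (comp_mpoly_is_multiplicative _).1]. Qed.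

HB.instance Definition _ := GRing.isZmodMorphism.Build _ _ dehomog
  dehomog_is_zmod_morphism.
HB.instance Definition _ := GRing.isMonoidMorphism.Build _ _ dehomog
  dehomog_is_monoid_morphism.

Lemma dehomogC c : dehomog c%:MP = c%:MP.
Proof. exact: comp_mpolyC. Qed.

Lemma dehomogX i : dehomog 'X_i = if unlift ord_max i is Some j then 'X_j else 1.
Proof. by rewrite /Defs.dehomog comp_mpolyXU -tnth_nth tnth_mktuple. Qed.

Lemma homogenise (p : {mpoly K[d]}) : exists N, forall n, (N <= n)%N ->
  exists2 a, a \is n.-homog for mdeg & dehomog a = p.
Proof.
have hz k : ('X_ord_max : {mpoly K[d.+1]}) ^+ k \is k.-homog for mdeg.
  rewrite -[X in X.-homog for _]mul1n; apply: dhomogMn.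
  by rewrite dhomogX /= mdeg1.
have dz k : dehomog ('X_ord_max ^+ k) = 1.
  by rewrite rmorphXn /= dehomogX unlift_none expr1n.
move: p; apply: mpoly_closed_ind => [c|i|p q [N1 h1] [N2 h2]|p q [N1 h1] [N2 h2]].
- exists 0%N => n _; exists (c *: 'X_ord_max ^+ n); first exact: dhomogZ.
  by rewrite -mul_mpolyC rmorphM /= dz dehomogC mulr1.
- exists 1%N => -[//|n] _; exists ('X_(lift ord_max i) * 'X_ord_max ^+ n).
    rewrite -[X in X.-homog for _]add1n; apply: dhomogM => //.
    by rewrite dhomogX /= mdeg1.
  by rewrite rmorphM /= dz mulr1 dehomogX liftK.
- exists (maxn N1 N2) => n; rewrite geq_max => /andP[/h1[a ha <-] /h2[b hb <-]].
  by exists (a + b); [apply: dhomogD|rewrite rmorphD].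
- exists (N1 + N2)%N => n le.
  have [//|a ha <-] := h1 N1; have [|b hb <-] := h2 (n - N1)%N.
    by rewrite leq_subRL // (leq_trans (leq_addr _ _) le).
  exists (a * b); last by rewrite rmorphM.
  rewrite -[X in X.-homog for _](subnKC (leq_trans (leq_addr N2 N1) le)).
  exact: dhomogM.
Qed.

Lemma homogenise2 (p q : {mpoly K[d]}) : exists n a b,
  [/\ a \is n.-homog for mdeg, b \is n.-homog for mdeg, dehomog a = p & dehomog b = q].
Proof.
have [N1 h1] := homogenise p; have [N2 h2] := homogenise q.
have [|a ha ea] := h1 (maxn N1 N2); first exact: leq_maxl.
have [|b hb eb] := h2 (maxn N1 N2); first exact: leq_maxr.
by exists (maxn N1 N2), a, b.
Qed.

End Homogeneous.

(** * Points as homomorphisms to fields *)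

Section Values.
Variables (K : fieldType) (d : nat).
Local Notation A := {mpoly K[d]}.
Local Notation dehomog := (@Defs.dehomog K d).

Section OneHom.
Variables (E : fieldType) (phi : {rmorphism A -> E}).

(** Homogeneous elements suffice to determine a homogeneous prime: P is the
    point of V which is the kernel of phi. *)
Definition kernel_of (P : set {mpoly K[d.+1]}) : Prop :=
  forall n a, a \is n.-homog for mdeg -> P a <-> phi (dehomog a) = 0.

(** A relation rather than a function, as f has a value only when it is
    regular at the kernel of phi. *)
Definition val_at (f : funfield K d) (c : E) : Prop :=
  exists a b : A, [/\ phi b != 0, f = a%:F / b%:F & c = phi a / phi b].

Lemma rmorph_neq0 b : phi b != 0 -> b != 0.
Proof. by apply: contraNneq => ->; rewrite rmorph0. Qed.

Lemma val_atE a b c : phi b != 0 -> val_at (a%:F / b%:F) c -> c = phi a / phi b.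
Proof.
move=> b0 [a' [b' [b'0 /frac_eqP E' ->]]]; apply/eqP; rewrite eqr_div //.
by rewrite -!rmorphM E' ?rmorph_neq0.
Qed.

Lemma val_at_inj f c c' : val_at f c -> val_at f c' -> c = c'.
Proof. by move=> [a [b [b0 -> ->]]] /val_atE ->. Qed.

Lemma val_at_poly p : val_at p%:F (phi p).
Proof. by exists p, 1; rewrite !rmorph1 !divr1 oner_eq0. Qed.

Lemma val_at_cst c : val_at (Defs.cst d c) (phi c%:MP).
Proof. exact: val_at_poly. Qed.

Lemma val_atD f g a b : val_at f a -> val_at g b -> val_at (f + g) (a + b).
Proof.
move=> [p [q [q0 -> ->]]] [p' [q' [q'0 -> ->]]].
exists (p * q' + p' * q), (q * q'); rewrite rmorphM mulf_neq0 //; split=> //.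
  by rewrite addf_div ?tofrac_eq0 ?rmorph_neq0 // rmorphD !rmorphM.
by rewrite addf_div // rmorphD !rmorphM.
Qed.

Lemma val_atM f g a b : val_at f a -> val_at g b -> val_at (f * g) (a * b).
Proof.
move=> [p [q [q0 -> ->]]] [p' [q' [q'0 -> ->]]].
exists (p * p'), (q * q'); rewrite rmorphM mulf_neq0 //; split=> //.
  by rewrite mulf_div !rmorphM.
by rewrite mulf_div !rmorphM.
Qed.

Lemma val_atV f a : val_at f a -> a != 0 -> val_at f^-1 a^-1.
Proof.
move=> [p [q [q0 -> ->]]]; rewrite mulf_eq0 negb_or => /andP[p0 _].
by exists q, p; rewrite !invf_div.
Qed.

Lemma localP_kernel P f : kernel_of P -> localP P f <-> exists c, val_at f c.
Proof.
move=> kP; split=> [[n [a [b [ha hb Pb ->]]]]|[c [a [b [b0 -> _]]]]].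
  exists (phi (dehomog a) / phi (dehomog b)), (dehomog a), (dehomog b).
  by split=> //; apply/eqP => /(kP _ _ hb).
have [n [a' [b' [ha hb Ea Eb]]]] := homogenise2 a b.
by exists n, a', b'; rewrite Ea Eb; split=> // /(kP _ _ hb); rewrite Eb; apply/eqP.
Qed.

(** The homogeneous prime is the kernel of the homomorphism to E[t] with
    x_i |-> t phi(x_i) and z |-> t, which sends a form a of degree n to
    t^n phi(a(x, 1)); being the kernel of a map to a domain, it is prime. *)
Lemma kernel_of_ppoint : exists P, [/\ ppoint P, in_V P & kernel_of P].
Proof.
have [ps psC psX] : exists2 ps : {rmorphism {mpoly K[d.+1]} -> {poly E}},
    forall c, ps c%:MP = (phi c%:MP)%:P & forall i, ps 'X_i = 'X * (phi (dehomog 'X_i))%:P.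
  exists (mmap (polyC \o phi \o @mpolyC d K) (fun i => 'X * (phi (dehomog 'X_i))%:P)).
    by move=> c; rewrite /= mmapC.
  by move=> i; rewrite /= mmapX mmap1U.
have psh n a : a \is n.-homog for mdeg -> ps a = 'X^n * (phi (dehomog a))%:P.
  move=> ha.
  rewrite (@homog_scale K _ _ ps (polyC \o phi \o dehomog) 'X _ _ n) //= => c.
  by rewrite psC dehomogC.
pose P : set {mpoly K[d.+1]} := [set q | ps q = 0].
have kP : kernel_of P.
  move=> n a ha; rewrite /P /= (psh _ _ ha).
  split=> [/eqP|->]; last by rewrite mulr0.
  by rewrite mulf_eq0 expf_eq0 polyX_eq0 andbF polyC_eq0 => /eqP.
have zP : in_V P.
  rewrite /in_V; rewrite (kP 1%N); last by rewrite dhomogX /= mdeg1.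
  by rewrite dehomogX unlift_none rmorph1; apply/eqP/oner_neq0.
exists P; split=> //; split; last by exists ord_max.
  split=> //=.
  - by rewrite /P /= rmorph0.
  - by rewrite /P /= rmorph1; apply/eqP/oner_neq0.
  - by rewrite /P /= => a b ha hb; rewrite rmorphD ha hb addr0.
  - split; first by rewrite /P /= => a b _ hb; rewrite rmorphM hb mulr0.
    rewrite /P /= => a b _ _ /eqP; rewrite rmorphM mulf_eq0.
    by case/orP => /eqP; [left|right].
move=> p n; rewrite /P /= => p0.
rewrite (psh n); last exact: pihomogP.
have : (ps p)`_n = 0 by rewrite p0 coef0.
rewrite [in X in X -> _](@pihomog_partitionE _ _ mdeg (msize p + n.+1) p); last first.
  exact: leq_addr.
rewrite rmorph_sum coef_sum.
under eq_bigr => i _ do rewrite (psh i) ?pihomogP // coefXnM coefC subn_eq0.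
have lt : (n < msize p + n.+1)%N by rewrite addnS ltnS leq_addl.
rewrite (bigD1 (Ordinal lt)) //= ltnn leqnn big1 ?addr0 => [->|i ne].
  by rewrite mulr0.
case: ltngtP => //= E'; case/eqP: ne; exact: val_inj.
Qed.

End OneHom.

(** The homomorphism maps x_i to the class of x_i / z in the fraction field of
    K[x, z] / P. *)
Lemma point_residue_field (P : set {mpoly K[d.+1]}) : ppoint P -> in_V P ->
  exists (E : fieldType) (phi : {rmorphism A -> E}), kernel_of phi P.
Proof.
move=> [Ppr _ _] zP; have [E [ps psP]] := residue_field Ppr.
pose z := ps 'X_ord_max.
have z0 : z != 0 by apply/eqP => /psP.
pose phi : {rmorphism A -> E} :=
  mmap (ps \o @mpolyC d.+1 K) (fun i => ps 'X_(lift ord_max i) / z).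
exists E, phi => n a ha; rewrite psP.
rewrite (@homog_scale K _ _ ps (phi \o dehomog) z _ _ n a ha) => [|c|i].
- split=> [/eqP|/= ->]; last by rewrite mulr0.
  by rewrite mulf_eq0 expf_eq0 (negPf z0) andbF => /eqP.
- by rewrite /phi /= dehomogC mmapC.
rewrite /phi /= dehomogX; case: unliftP => [j|] ->; last by rewrite rmorph1 mulr1.
by rewrite mmapX mmap1U mulrC divfK.
Qed.

End Values.

Section Points.
Variables (K : fieldType) (gT : finGroupType) (d : nat).
Variable rG : mx_representation K [set: gT]%G d.
Local Notation A := {mpoly K[d]}.
Variables (E : fieldType) (phi : {rmorphism A -> E}).

Lemma localQ_kernel P (H : {set gT}) f : kernel_of phi P ->
  localQ rG H P f <-> invariants rG H f /\ exists c, val_at phi f c.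
Proof.
move=> kP; split=> [[/(localP_kernel _ kP)]|[i /(localP_kernel _ kP)]] //.
Qed.

(** If x f = c while f - c has a nonzero value e at P, then f - c is invertible
    in the local ring, although x maps it to 0. *)
Lemma point_atP P (H : {set gT}) x : kernel_of phi P ->
  point_at rG H idfun x P ->
  forall f c, x f = Some c <-> invariants rG H f /\ val_at phi f (phi c%:MP).
Proof.
move=> kP [dom xC xDM _] f c.
have imp f' c' : x f' = Some c' -> invariants rG H f' /\ val_at phi f' (phi c'%:MP).
  move=> xf.
  have /(localQ_kernel _ _ kP)[inv [e ve]] : localQ rG H P f' by apply/dom; exists c'.
  split=> //; suff <- : e = phi c'%:MP by [].
  have [//|ne] := eqVneq e (phi c'%:MP).
  pose g := f' + Defs.cst d (- c').
  have [xg _] := xDM _ _ _ _ xf (xC (- c')); rewrite subrr in xg.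
  have vg : val_at phi g (e - phi c'%:MP).
    by rewrite -rmorphN -rmorphN; apply: val_atD => //; apply: val_at_cst.
  have e0 : e - phi c'%:MP != 0 by rewrite subr_eq0.
  have g0 : g != 0.
    apply: contraNneq e0 => g0; rewrite g0 in vg; apply/eqP/(val_at_inj vg).
    by have := val_at_poly phi 0; rewrite !rmorph0.
  have inv' : invariants rG H g.
    by apply: invariantsD => //; apply: invariants_cst.
  have /dom[w xw] : localQ rG H P g^-1.
    apply/(localQ_kernel _ _ kP); split; first exact: invariantsV.
    by exists (e - phi c'%:MP)^-1; apply: val_atV.
  have [_] := xDM _ _ _ _ xg xw; rewrite mul0r mulfV //.
  have := xC 1; rewrite /Defs.cst mpolyC1 rmorph1 => -> [] /eqP.
  by rewrite oner_eq0.
split=> [/imp//|[inv v]].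
have /dom[c' xf] : localQ rG H P f.
  by apply/(localQ_kernel _ _ kP); split=> //; exists (phi c%:MP).
have [_ v'] := imp _ _ xf; rewrite xf; congr Some.
have : (phi \o @mpolyC d K) c' = (phi \o @mpolyC d K) c := val_at_inj v' v.
exact: fmorph_inj.
Qed.

(** The values of invariant functions must lie in K for them to define a
    K-point. *)
Lemma point_atI P (H : {set gT}) x : kernel_of phi P ->
  (forall f e, invariants rG H f -> val_at phi f e -> exists c, e = phi c%:MP) ->
  (forall f c, x f = Some c <-> invariants rG H f /\ val_at phi f (phi c%:MP)) ->
  point_at rG H idfun x P.
Proof.
move=> kP rat xP; split=> [f|c|f g a b xf xg|f].
- rewrite (localQ_kernel _ _ kP); split=> [[inv [e ve]]|[c /xP[inv v]]].
    have [c ec] := rat f e inv ve; exists c; apply/xP; split=> //.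
    by rewrite -ec.
  by split=> //; exists (phi c%:MP).
- by apply/xP; split; [apply: invariants_cst|apply: val_at_cst].
- move/xP: xf => [i v]; move/xP: xg => [i' v']; split; apply/xP.
    by split; [apply: invariantsD|rewrite !rmorphD; apply: val_atD].
  by split; [apply: invariantsM|rewrite !rmorphM; apply: val_atM].
- move=> /(localQ_kernel _ _ kP)[inv [e ve]] nl; apply/xP; split=> //.
  rewrite !rmorph0; have [<-//|e0] := eqVneq e 0.
  case: nl; apply/(localQ_kernel _ _ kP); split; first exact: invariantsV.
  by exists e^-1; apply: val_atV.
Qed.

End Points.

(** * Triviality of inertia at unramified points *)

Section DualNumbers.
Variable E : fieldType.

(** The pair (x, y) is x + y eps with eps ^ 2 = 0.  The name keeps this ring
    apart from the product ring E * E. *)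
Definition dual := (E * E)%type.
HB.instance Definition _ := GRing.Zmodule.on dual.

Definition dual_mul (u v : dual) : dual := (u.1 * v.1, u.1 * v.2 + u.2 * v.1).

Lemma dual_mulA : associative dual_mul.
Proof. by move=> u v w; congr pair; rewrite /=; ring. Qed.
Lemma dual_mulC : commutative dual_mul.
Proof. by move=> u v; congr pair; rewrite /=; ring. Qed.
Lemma dual_mul1 : left_id ((1, 0) : dual) dual_mul.
Proof. by case=> x y; congr pair; rewrite /=; ring. Qed.
Lemma dual_mulD : left_distributive dual_mul +%R.
Proof. by move=> u v w; congr pair; rewrite /=; ring. Qed.
Lemma dual_1_neq0 : ((1, 0) : dual) != 0.
Proof. by apply/eqP => -[/eqP]; rewrite oner_eq0. Qed.

HB.instance Definition _ := GRing.Zmodule_isComNzRing.Build dual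
  dual_mulA dual_mulC dual_mul1 dual_mulD dual_1_neq0.

Definition dual_re (u : dual) : E := u.1.
Lemma dual_re_zmod : zmod_morphism dual_re. Proof. by []. Qed.
Lemma dual_re_monoid : monoid_morphism dual_re. Proof. by []. Qed.
HB.instance Definition _ := GRing.isZmodMorphism.Build dual E dual_re dual_re_zmod.
HB.instance Definition _ := GRing.isMonoidMorphism.Build dual E dual_re dual_re_monoid.

Definition dual_in (x : E) : dual := (x, 0).
Lemma dual_in_zmod : zmod_morphism dual_in.
Proof. by move=> x y; congr pair; rewrite subr0. Qed.
Lemma dual_in_monoid : monoid_morphism dual_in.
Proof. by split=> // x y; congr pair; rewrite /= mulr0 mul0r addr0. Qed.
HB.instance Definition _ := GRing.isZmodMorphism.Build E dual dual_in dual_in_zmod.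
HB.instance Definition _ := GRing.isMonoidMorphism.Build E dual dual_in dual_in_monoid.

Definition dual_inv (u : dual) : dual := (u.1^-1, - u.2 / u.1 ^+ 2).

Lemma dual_mulV (u : dual) : dual_re u != 0 -> u * dual_inv u = 1.
Proof.
case: u => x y /= x0; congr pair; rewrite /=; first by rewrite mulfV.
by rewrite mulNr expr2 invfM mulrN !mulrA (mulrC x) mulfK // mulrC addNr.
Qed.

Lemma dual_inv1 : dual_inv 1 = 1.
Proof. by congr pair; rewrite /= ?invr1 // oppr0 mul0r. Qed.

Lemma dual_re_eq0M (u v : dual) : dual_re u = 0 -> dual_re v = 0 -> u * v = 0.
Proof.
case: u v => x y [z t] /= -> ->; congr pair; rewrite /= ?mul0r //.
by rewrite mulr0 addr0.
Qed.

End DualNumbers.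

Section Inertia.
Variables (K : fieldType) (gT : finGroupType) (d : nat).
Variable rG : mx_representation K [set: gT]%G d.
Local Notation A := {mpoly K[d]}.
Local Notation act := (act_poly rG).
Variables (E : fieldType) (phi : {rmorphism A -> E}).

Section DualPoint.
Variable psi : {rmorphism A -> dual E}.
Hypothesis psi_re : forall p, dual_re (psi p) = phi p.

(** The extension to the local ring of a homomorphism to the dual numbers which
    lifts phi: denominators which phi does not kill become invertible. *)
Definition dual_val (f : funfield K d) : dual E :=
  xget 0 [set c | exists a b, [/\ phi b != 0, f = a%:F / b%:F &
                                  c = psi a * dual_inv (psi b)]].

Lemma psi_inv b : phi b != 0 -> psi b * dual_inv (psi b) = 1.
Proof. by rewrite -psi_re; apply: dual_mulV. Qed.

Lemma dual_valE a b : phi b != 0 -> dual_val (a%:F / b%:F) = psi a * dual_inv (psi b).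
Proof.
move=> b0; rewrite /dual_val; case: xgetP => [c -> [a' [b' [b'0 /frac_eqP E' ->]]]|].
  have {}E' : psi a * psi b' = psi a' * psi b.
    by rewrite -!rmorphM E' ?(rmorph_neq0 b0) ?(rmorph_neq0 b'0).
  rewrite -[LHS]mulr1 -[RHS]mulr1 -{1}(psi_inv b0) -(psi_inv b'0).
  by rewrite !mulrA [psi a' * _ * _]mulrAC -E'; ring.
by move/(_ (psi a * dual_inv (psi b)))=> []; exists a, b.
Qed.

Lemma dual_val_rmorph P : kernel_of phi P -> rmorph_on (localP P) dual_val.
Proof.
move=> kP; split.
  have := @dual_valE 1 1; rewrite !rmorph1 divr1 oner_neq0 => -> //.
  by rewrite dual_inv1 mulr1.
move=> f g /(localP_kernel _ kP)[_ [a [b [b0 -> _]]]].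
move=> /(localP_kernel _ kP)[_ [a' [b' [b'0 -> _]]]].
have bb' : phi (b * b') != 0 by rewrite rmorphM mulf_neq0.
have invM : dual_inv (psi (b * b')) = dual_inv (psi b) * dual_inv (psi b').
  rewrite -[RHS]mul1r -(psi_inv bb') rmorphM.
  rewrite -[LHS]mul1r -{1}(mulr1 1) -{1}(psi_inv b0) -(psi_inv b'0).
  by ring.
have [nb nb'] := (rmorph_neq0 b0, rmorph_neq0 b'0).
rewrite addf_div ?tofrac_eq0 // mulf_div -!rmorphM -rmorphD !dual_valE // invM.
split; last by rewrite rmorphM mulrACA.
rewrite rmorphD !rmorphM mulrDl mulrACA psi_inv // mulr1.
by rewrite [dual_inv (psi b) * _]mulrC mulrACA psi_inv // mulr1.
Qed.

Lemma dual_val_re P f c : kernel_of phi P -> val_at phi f c -> dual_re (dual_val f) = c.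
Proof.
move=> kP [a [b [b0 -> ->]]]; rewrite dual_valE //.
by rewrite -!psi_re.
Qed.

End DualPoint.

(** Let psi be phi moved by eps in the direction of the i-th coordinate.  Since
    g fixes phi, psi and psi o g are lifts of phi; they agree on invariants, and
    by unramifiedness everywhere.  On the j-th coordinate the coefficients of
    eps are (i == j) and the (i, j) entry of the matrix of g. *)
Lemma inertia_trivial P g : mx_faithful rG -> kernel_of phi P ->
  formally_unramified (localQ rG [set: gT]%SET P) (localP P) ->
  (forall p, phi (act g p) = phi p) -> g = 1%g.
Proof.
move=> faith kP unr gphi; apply/set1gP; move: faith; rewrite /mx_faithful => /fintype.subsetP; apply.
apply/rkerP; split; first by rewrite inE.
apply/matrixP => i j.
have [psi [psiC psiX]] : exists psi : {rmorphism A -> dual E},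
    (forall c, psi c%:MP = dual_in (phi c%:MP)) /\
    forall k, psi 'X_k = (phi 'X_k, (i == k)%:R).
  exists (mmap (@dual_in E \o phi \o @mpolyC d K) (fun k => (phi 'X_k, (i == k)%:R))).
  by split=> [c|k]; rewrite /= ?mmapC // mmapX mmap1U.
have psi_re : forall p, dual_re (psi p) = phi p.
  apply: (@mpoly_rmorph_ext _ _ _ (@dual_re E \o psi) phi) => [c|k] /=.
    by rewrite psiC.
  by rewrite psiX.
pose psig : {rmorphism A -> dual E} := psi \o act g.
have psig_re p : dual_re (psig p) = phi p by rewrite /= psi_re gphi.
have dual_val_inv f : localQ rG [set: gT]%SET P f -> dual_val psig f = dual_val psi f.
  move=> /(localQ_kernel _ _ _ kP)[inv [c [a [b [b0 Ef _]]]]].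
  have := inv; rewrite Ef => /(invariants_div rG _ a (rmorph_neq0 b0))/(_ g (finset.in_setT _)) E'.
  rewrite (dual_valE psig_re) // (dual_valE psi_re) //=.
  have {}E' : psi (act g a) * psi b = psi a * psi (act g b) by rewrite -!rmorphM E'.
  have b'0 : phi (act g b) != 0 by rewrite gphi.
  rewrite -[LHS]mulr1 -[RHS]mulr1 -{1}(psi_inv psi_re b0) -(psi_inv psi_re b'0).
  by rewrite mulrACA [RHS]mulrACA E' [dual_inv _ * _]mulrC.
have lP : lifting_problem (localQ rG [set: gT]%SET P) (localP P) (@dual_re E) (dual_val psi)
    (@dual_re E \o dual_val psi).
  have dm := dual_val_rmorph psi_re kP; split=> //.
  - by move=> y; exists (dual_in y).
  - exact: dual_re_eq0M.
  - split=> [|a b [la _] [lb _]]; first exact: dm.1.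
    exact: dm.2.
  - split=> [|a b la lb]; first by rewrite /= dm.1 rmorph1.
    by rewrite /= (dm.2 _ _ la lb).1 (dm.2 _ _ la lb).2 rmorphD rmorphM.
have l1 : is_lift (localQ rG [set: gT]%SET P) (localP P) (@dual_re E) (dual_val psi)
    (@dual_re E \o dual_val psi) (dual_val psi).
  by split=> //; exact: dual_val_rmorph.
have l2 : is_lift (localQ rG [set: gT]%SET P) (localP P) (@dual_re E) (dual_val psi)
    (@dual_re E \o dual_val psi) (dual_val psig).
  split=> //; first exact: (dual_val_rmorph psig_re).
  move=> f /(localP_kernel _ kP)[c vc] /=.
  by rewrite (dual_val_re psig_re kP vc) (dual_val_re psi_re kP vc).
have := unr _ _ _ _ _ lP _ _ l1 l2 ('X_j)%:F.
have pj (chi : {rmorphism A -> dual E}) : (forall p, dual_re (chi p) = phi p) ->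
    dual_val chi ('X_j)%:F = chi 'X_j.
  move=> hchi; have := @dual_valE chi hchi 'X_j 1.
  rewrite !rmorph1 divr1 oner_neq0 => -> //.
  by rewrite dual_inv1 mulr1.
have Xl : localP P ('X_j)%:F.
  by apply/(localP_kernel _ kP); exists (phi 'X_j); apply: val_at_poly.
move=> /(_ Xl); rewrite !pj //= act_polyX rmorph_sum psiX /= => /(congr1 snd) /=.
rewrite (big_morph (fun u : dual E => u.2) (fun _ _ => erefl) erefl) (bigD1 i) //=.
rewrite big1 => [|k ne]; rewrite -mul_mpolyC rmorphM psiC psiX /= mul0r addr0; last first.
  by rewrite eq_sym (negPf ne) mulr0.
rewrite eqxx mulr1 addr0 mxE => E'; apply: (fmorph_inj (phi \o @mpolyC d K)).
by rewrite /= -E' rmorph_nat /= rmorph_nat.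
Qed.

End Inertia.

(** * Orbit polynomials and homomorphisms over the same point *)

(** A finite union of proper subspaces does not contain the whole curve of
    vectors (1, t, t^2, ..): on the curve each of the finitely many linear
    forms is a nonzero polynomial in t. *)
Lemma moment_curve_avoids (E : fieldType) d (J : finType) (lam : J -> 'I_d -> E) :
  [pchar E] =i pred0 -> (forall j, exists i, lam j i != 0) ->
  exists t : nat, forall j, \sum_(i < d) t%:R ^+ i * lam j i != 0.
Proof.
move=> ch0 lam0; pose p j := \sum_(i < d) lam j i *: 'X^i.
have p0 j : p j != 0.
  have [i li] := lam0 j; apply: contra_neq li => pj0.
  have : (p j)`_i = 0 by rewrite pj0 coef0.
  rewrite coef_sum (bigD1 i) //= coefZ coefXn eqxx mulr1 big1 ?addr0 // => k ne.
  by rewrite coefZ coefXn eq_sym val_eqE (negPf ne) mulr0.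
pose q := \prod_j p j.
have q0 : q != 0 by apply/prodf_neq0.
have qE j t : root (p j) t -> root q t.
  by rewrite /q (bigD1 j) //= rootM => ->.
have pE j (t : nat) : (p j).[t%:R] = \sum_(i < d) t%:R ^+ i * lam j i.
  by rewrite horner_sum; apply: eq_bigr => i _; rewrite hornerZ hornerXn mulrC.
apply: contrapT => /forallNP none.
(* Otherwise 0, .., size q - 1 are too many roots of q. *)
suff : (size [seq t%:R : E | t <- iota 0 (size q)] < size q)%N.
  by rewrite size_map size_iota ltnn.
apply: max_poly_roots => //.
  apply/allP => _ /mapP[t _ ->]; have /existsNP[j /negP] := none t.
  by rewrite negbK -pE => /(qE j).
rewrite map_inj_uniq ?iota_uniq // => a b /eqP.
wlog le : a b / (a <= b)%N.
  by move=> W; case: (ssrnat.leqP a b) => [/W//|/ltnW/W h /eqP e]; rewrite h // e.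
rewrite eq_sym -subr_eq0 -natrB // (pcharf0P _).1 // subn_eq0 => le'.
by apply/eqP; rewrite eqn_leq le.
Qed.

Lemma separating_form (K : fieldType) d (E : fieldType) (J : finType)
    (f g : J -> {rmorphism {mpoly K[d]} -> E}) :
  [pchar E] =i pred0 -> (forall j, exists i, f j 'X_i != g j 'X_i) ->
  exists l, forall j, f j l != g j l.
Proof.
move=> ch0 ne.
have [j|t ht] := @moment_curve_avoids E d J (fun j i => f j 'X_i - g j 'X_i) ch0.
  by have [i hi] := ne j; exists i; rewrite subr_eq0.
exists (\sum_(i < d) t%:R ^+ i * 'X_i) => j; rewrite -subr_eq0.
rewrite !rmorph_sum -sumrB; move: (ht j); congr (_ != 0).
by apply: eq_bigr => i _; rewrite !rmorphM !rmorphXn !rmorph_nat mulrBr.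
Qed.

Section OrbitPolynomials.
Variables (K : fieldType) (gT : finGroupType) (d : nat).
Variable rG : mx_representation K [set: gT]%G d.
Local Notation A := {mpoly K[d]}.
Local Notation act := (act_poly rG).
Local Notation G := [set: gT]%SET.

Definition orbit_poly (H : {set gT}) (l : A) : {poly A} :=
  \prod_(h in H) ('X - (act h l)%:P).

(** The interpolation polynomial with value f * prod_(h <> 1) (l - h l) at l;
    without denominators, its coefficients are invariant polynomials. *)
Definition lagrange_poly (l f : A) : {poly A} :=
  \sum_g (act g f) *: \prod_(h | h != g) ('X - (act h l)%:P).

Lemma orbit_poly_inv (H : {group gT}) l i : invpoly rG H (orbit_poly H l)`_i.
Proof.
move=> h hH; rewrite -coef_map; congr (polyseq _)`_i.
rewrite /orbit_poly rmorph_prod (reindex_inj (mulgI h^-1%g)) /=.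
apply: eq_big => [k|k kH]; first by rewrite groupMl ?groupV.
by rewrite map_polyXsubC /= -act_polyM mulKVg.
Qed.

Lemma orbit_polyG_inv l i : invpoly rG G (orbit_poly G l)`_i.
Proof. exact: (@orbit_poly_inv [set: gT]%G). Qed.

Lemma lagrange_poly_inv l f i : invpoly rG G (lagrange_poly l f)`_i.
Proof.
move=> h _; rewrite -coef_map; congr (polyseq _)`_i.
rewrite /lagrange_poly rmorph_sum (reindex_inj (mulgI h^-1%g)) /=.
apply: eq_bigr => g _; rewrite map_polyZ /= -act_polyM mulKVg; congr (_ *: _).
rewrite rmorph_prod (reindex_inj (mulgI h^-1%g)) /=.
apply: eq_big => [k|k _]; first by rewrite (inj_eq (mulgI _)).
by rewrite map_polyXsubC /= -act_polyM mulKVg.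
Qed.

Variables (E : fieldType) (phi : {rmorphism A -> E}).

Lemma map_prod_XsubC (Q : pred gT) l :
  map_poly phi (\prod_(h | Q h) ('X - (act h l)%:P)) =
  \prod_(h | Q h) ('X - (phi (act h l))%:P).
Proof. by rewrite rmorph_prod; apply: eq_bigr => h _; rewrite /= map_polyXsubC. Qed.

Lemma map_orbit_poly (H : {set gT}) l :
  map_poly phi (orbit_poly H l) = \prod_(h in H) ('X - (phi (act h l))%:P).
Proof. exact: map_prod_XsubC. Qed.

Lemma horner_prod_XsubC (Q : pred gT) l y :
  (\prod_(h | Q h) ('X - (phi (act h l))%:P)).[y] =
  \prod_(h | Q h) (y - phi (act h l)).
Proof. by rewrite horner_prod; apply: eq_bigr => h _; rewrite hornerXsubC. Qed.

Lemma horner_lagrange_poly l f : (map_poly phi (lagrange_poly l f)).[phi l] =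
  phi f * \prod_(h | h != 1%g) (phi l - phi (act h l)).
Proof.
rewrite rmorph_sum horner_sum (bigD1 1%g) //= [X in _ + X]big1 ?addr0 => [|g g1].
  by rewrite map_polyZ hornerZ act_poly1 map_prod_XsubC horner_prod_XsubC.
rewrite map_polyZ hornerZ map_prod_XsubC horner_prod_XsubC.
by rewrite (bigD1 1%g) ?(eq_sym 1%g) //= act_poly1 subrr mul0r mulr0.
Qed.

Lemma root_orbit_poly (H : {set gT}) l y :
  root (map_poly phi (orbit_poly H l)) y <-> exists2 h, h \in H & y = phi (act h l).
Proof.
rewrite map_orbit_poly rootE horner_prod_XsubC; split=> [|[h hH ->]].
  by move/prodf_eq0 => [h hH]; rewrite subr_eq0 => /eqP ->; exists h.
by rewrite (bigD1 h) //= subrr mul0r.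
Qed.

Lemma orbit_poly_root l : root (map_poly phi (orbit_poly G l)) (phi l).
Proof. by apply/root_orbit_poly; exists 1%g; rewrite ?inE ?act_poly1. Qed.

End OrbitPolynomials.

Section Specialisation.
Variables (K : fieldType) (gT : finGroupType) (d : nat).
Variable rG : mx_representation K [set: gT]%G d.
Local Notation A := {mpoly K[d]}.
Local Notation act := (act_poly rG).
Local Notation G := [set: gT]%SET.

(** For each l, the values of phi' and phi on the coefficients of
    prod_g (T - g l) agree, so phi' l is one of the phi (g l).  If no g worked
    for all polynomials, a separating linear form l would contradict this. *)
Lemma lies_over_conjugate (E : fieldType) (phi phi' : {rmorphism A -> E}) :
  [pchar E] =i pred0 -> (forall p, invpoly rG G p -> phi' p = phi p) ->
  exists g, forall p, phi' p = phi (act g p).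
Proof.
move=> ch0 same; apply: contrapT => /forallNP none.
have [g|l hl] := @separating_form K d E gT (fun=> phi') (fun g => phi \o act g) ch0.
  apply: contrapT => /forallNP h; apply: (none g).
  apply: (@mpoly_rmorph_ext _ _ _ phi' (phi \o act g)) => [c|i] /=.
    by rewrite act_polyC same // => h' _; rewrite act_polyC.
  by apply/eqP; apply: contrapT => /negP; apply: h.
have := orbit_poly_root rG phi' l.
have -> : map_poly phi' (orbit_poly rG G l) = map_poly phi (orbit_poly rG G l).
  by apply/polyP => i; rewrite !coef_map /=; apply: same; apply: orbit_polyG_inv.
by move=> /root_orbit_poly[g _ /eqP]; rewrite (negPf (hl g)).
Qed.

(** Treating two homomorphisms at once ensures that they give the same
    polynomial over K, although their targets are unrelated fields. *)
Lemma invariant_poly_spec (E E' : fieldType) (phi : {rmorphism A -> E})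
    (phi' : {rmorphism A -> E'}) (H : {set gT}) (q : {poly A}) :
  (forall p, invpoly rG H p -> exists2 c, phi p = phi c%:MP & phi' p = phi' c%:MP) ->
  (forall i, invpoly rG H q`_i) ->
  exists r : {poly K}, map_poly phi q = map_poly (phi \o @mpolyC d K) r /\
                       map_poly phi' q = map_poly (phi' \o @mpolyC d K) r.
Proof.
move=> rat inv.
have /choice[c hc] i : exists c, phi q`_i = phi c%:MP /\ phi' q`_i = phi' c%:MP.
  by have [c h h'] := rat _ (inv i); exists c.
exists (\poly_(i < size q) c i); split; apply/polyP => i; rewrite !coef_map coef_poly /=.
  have [lt|le] := ltnP i (size q); first exact: (hc i).1.
  by rewrite nth_default // mpolyC0 !rmorph0.
have [lt|le] := ltnP i (size q); first exact: (hc i).2.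
by rewrite nth_default // mpolyC0 !rmorph0.
Qed.

Lemma invariant_poly_rat (E : fieldType) (phi : {rmorphism A -> E}) (H : {set gT})
    (q : {poly A}) :
  (forall p, invpoly rG H p -> exists c, phi p = phi c%:MP) ->
  (forall i, invpoly rG H q`_i) ->
  exists r : {poly K}, map_poly phi q = map_poly (phi \o @mpolyC d K) r.
Proof.
move=> rat inv.
have [|r [Er _]] := invariant_poly_spec (phi := phi) (phi' := phi) _ inv; last by exists r.
by move=> p /rat[c h]; exists c.
Qed.

End Specialisation.

(** * Field extensions and torsors *)

Lemma rmorph_factor (B L C : comNzRingType) (f : {rmorphism B -> L})
    (g : {rmorphism B -> C}) :
  (forall y, exists b, f b = y) -> (forall b, f b = 0 -> g b = 0) ->
  exists h : {rmorphism L -> C}, forall b, h (f b) = g b.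
Proof.
move=> /choice[s sK] ker; pose h y := g (s y).
have hf b : h (f b) = g b.
  by apply/eqP; rewrite -subr_eq0 -rmorphB ker // rmorphB sK subrr.
have hz : zmod_morphism h.
  by move=> x y; rewrite -(sK x) -(sK y) -rmorphB !hf rmorphB.
have hm : monoid_morphism h.
  split=> [|x y]; first by rewrite -(rmorph1 f) hf rmorph1.
  by rewrite -(sK x) -(sK y) -rmorphM !hf rmorphM.
pose mz := GRing.isZmodMorphism.Build L C h hz.
pose mm := GRing.isMonoidMorphism.Build L C h hm.
pose hh : {rmorphism L -> C} := HB.pack h mz mm.
by exists hh.
Qed.

Lemma ahom_of_rmorph (K : fieldType) (L L' : fieldExtType K) (h : {rmorphism L -> L'}) :
  (forall c, h c%:A = c%:A) -> exists t : 'AHom(L, L'), forall x, t x = h x.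
Proof.
move=> hc.
have hs : scalable h by move=> c x; rewrite -mulr_algl rmorphM hc mulr_algl.
pose ms := GRing.isScalable.Build K L L' _ h hs.
pose hh : {lrmorphism L -> L'} := HB.pack (GRing.RMorphism.sort h) ms.
by exists (linfun_ahom hh) => x; exact: (lfunE hh).
Qed.

Lemma ahom_factor (K : fieldType) (L L' : fieldExtType K) (B : comNzRingType)
    (f : {rmorphism B -> L}) (g : {rmorphism B -> L'}) (k : K -> B) :
  (forall c, f (k c) = c%:A) -> (forall c, g (k c) = c%:A) ->
  (forall y, exists b, f b = y) -> (forall b, f b = 0 -> g b = 0) ->
  exists t : 'AHom(L, L'), forall b, t (f b) = g b.
Proof.
move=> fk gk fs ker; have [h hf] := rmorph_factor fs ker.
have [|t th] := @ahom_of_rmorph K L L' h; first by move=> c; rewrite -fk hf gk.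
by exists t => b; rewrite th hf.
Qed.

Lemma primitive_generates (K : fieldType) (L : fieldExtType K) (z : L) :
  <<1; z>>%VS = fullv -> forall y, exists r : {poly K}, (map_poly (in_alg L) r).[z] = y.
Proof.
move=> gen y; have : y \in <<1; z>>%VS by rewrite gen memvf.
by move/Fadjoin_polyP => [q /polyOver1P[r ->] ->]; exists r.
Qed.

Lemma ahom_horner (K : fieldType) (L L' : fieldExtType K) (t : 'AHom(L, L'))
    (r : {poly K}) z :
  t (map_poly (in_alg L) r).[z] = (map_poly (in_alg L') r).[t z].
Proof.
rewrite -horner_map -map_poly_comp; congr (_.[_]).
by apply: eq_map_poly => c /=; rewrite linearZ /= rmorph1.
Qed.

Lemma root_over_ahom (K : fieldType) (L : fieldExtType K) (t : 'AEnd(L)) (r : {poly K}) z :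
  root (map_poly (in_alg L) r) z -> root (map_poly (in_alg L) r) (t z).
Proof. by rewrite !rootE -ahom_horner => /eqP ->; rewrite rmorph0. Qed.

Lemma primitive_ahom (K : fieldType) (L L' : fieldExtType K) (z : L) (z' : L') :
  <<1; z>>%VS = fullv ->
  (forall r : {poly K}, root (map_poly (in_alg L) r) z -> root (map_poly (in_alg L') r) z') ->
  exists t : 'AHom(L, L'), t z = z'.
Proof.
move=> gen rootz.
pose f := horner_eval z \o map_poly (in_alg L).
pose f' := horner_eval z' \o map_poly (in_alg L').
have [|||b fb0|t ht] := @ahom_factor K L L' {poly K} f f' polyC.
- by move=> c; rewrite /f /= /horner_eval map_polyC hornerC.
- by move=> c; rewrite /f' /= /horner_eval map_polyC hornerC.
- exact: primitive_generates gen.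
- by apply/eqP/rootz/eqP.
exists t; have := ht 'X; rewrite /f /f' /= /horner_eval !map_polyX !hornerX.
by move=> ->.
Qed.

Lemma primitive_surj (K : fieldType) d (L : fieldExtType K)
    (phi : {rmorphism {mpoly K[d]} -> L}) l :
  (forall c, phi c%:MP = c%:A) -> <<1; phi l>>%VS = fullv ->
  forall y, exists p, phi p = y.
Proof.
move=> phiC gen y; have [r <-] := primitive_generates gen y.
exists (map_poly (@mpolyC d K) r).[l].
rewrite -horner_map -map_poly_comp; congr (_.[_]).
by apply: eq_map_poly => c /=; apply: phiC.
Qed.

Section TorsorCriteria.
Variables (K : fieldType) (gT : finGroupType) (L : fieldExtType K).
Variable s : gT -> 'AEnd(L).
Local Notation n := (\dim {:L}).
Local Notation b := (vbasis {:L}).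

Definition galois_mx : 'M[L]_(n, #|gT|) := \matrix_(j, k) s (enum_val k) b`_j.
Definition torsor_map (a : {ffun 'I_n -> L}) : {ffun gT -> L} :=
  [ffun g => \sum_(j < n) a j * s g b`_j].

Lemma torsor_map_mx a g :
  torsor_map a g = ((\row_j a j) *m galois_mx) 0 (enum_rank g).
Proof.
rewrite ffunE mxE; apply: eq_bigr => j _; rewrite !mxE.
by rewrite enum_rankK.
Qed.

Lemma sum_coord x : \sum_(j < n) coord b j x *: b`_j = x.
Proof. by rewrite -coord_vbasis ?memvf. Qed.

(** The image of c (x) x under the torsor map L (x) L -> L^G, with x written in
    the basis of L. *)
Lemma torsor_map_alg x c : torsor_map [ffun j => c * (coord b j x)%:A] = [ffun g => c * s g x].
Proof.
apply/ffunP => g; rewrite !ffunE -[in RHS](sum_coord x) linear_sum mulr_sumr.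
by apply: eq_bigr => j _; rewrite ffunE linearZ /= -mulrA mulr_algl.
Qed.

Hypothesis T : torsor s.

Lemma torsor_inj : injective torsor_map.
Proof. exact: bij_inj T. Qed.

Lemma torsor_dim : \dim {:L} = #|gT|.
Proof.
have [U UT TU] := T.
have free : row_free galois_mx.
  apply: inj_row_free => v v0.
  suff : [ffun j => v 0 j] = [ffun => 0] :> {ffun 'I_n -> L}.
    by move=> E; apply/rowP => j; move/ffunP/(_ j): E; rewrite !ffunE mxE.
  apply: torsor_inj; apply/ffunP => g; rewrite !torsor_map_mx.
  rewrite (_ : (\row_j _) = v); last by apply/rowP => j; rewrite mxE ffunE.
  rewrite v0 (_ : (\row_j _) = 0) ?mul0mx //.
  by apply/rowP => j; rewrite !mxE ffunE.
have full : row_full galois_mx.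
  apply/row_fullP; exists (\matrix_(k, j) U [ffun g => (g == enum_val k)%:R] j).
  apply/matrixP => k k'; have := TU [ffun g => (g == enum_val k)%:R].
  move/ffunP/(_ (enum_val k')); rewrite !ffunE (inj_eq enum_val_inj) => E.
  rewrite [RHS]mxE eq_sym -E mxE; apply: eq_bigr => j _; rewrite !mxE //.
by move: free full; rewrite /row_free /row_full => /eqP -> /eqP.
Qed.

(** If x is fixed by G, the torsor map identifies 1 (x) x with x (x) 1, so these
    are equal; comparing coordinates in a basis of L over K gives x in K. *)
Lemma torsor_fixed x : (forall g, s g x = x) -> exists c, x = c%:A.
Proof.
move=> fx.
have E : [ffun j => 1 * (coord b j x)%:A] = [ffun j => x * (coord b j 1)%:A] :> {ffun 'I_n -> L}.
  apply: torsor_inj; rewrite !torsor_map_alg; apply/ffunP => g.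
  by rewrite !ffunE fx rmorph1 mul1r mulr1.
have [j cj] : exists j, coord b j (1 : L) != 0.
  apply: contrapT => /forallNP h; have /eqP := oner_neq0 L; apply.
  rewrite -[LHS]sum_coord big1 // => j _.
  by have /negP := h j; rewrite negbK => /eqP ->; rewrite scale0r.
exists (coord b j x / coord b j 1); move/ffunP/(_ j): E; rewrite !ffunE mul1r.
rewrite mulr_algr => E'; rewrite mulrC -scalerA E' scalerA mulVf //.
by rewrite scale1r.
Qed.

End TorsorCriteria.

(** The torsor map is surjective by Lagrange interpolation at the conjugates of
    z: the polynomial which is 1 at g z and 0 at the other conjugates, with its
    powers of the variable read in the second factor of L (x) L, is sent to the
    indicator of g.  Dimensions being equal, the map is bijective. *)
Lemma torsor_of_distinct (K : fieldType) (gT : finGroupType) (L : fieldExtType K)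
    (s : gT -> 'AEnd(L)) (z : L) :
  \dim {:L} = #|gT| -> injective (fun g => s g z) -> torsor s.
Proof.
move=> dimL inj; set n := \dim {:L} in dimL *; pose b := vbasis {:L}.
pose M := galois_mx s.
have full : row_full M.
  apply/row_fullP.
  pose q (k : 'I_#|gT|) : {poly L} := \prod_(h | h != enum_val k) ('X - (s h z)%:P).
  pose w (k : 'I_#|gT|) : L := \prod_(h | h != enum_val k) (s (enum_val k) z - s h z).
  exists (\matrix_(k, j) ((w k)^-1 * \sum_(i < size (q k)) (q k)`_i * (coord b j (z ^+ i))%:A)).
  apply/matrixP => k k'; rewrite !mxE.
  transitivity ((w k)^-1 * (q k).[s (enum_val k') z]).
    rewrite horner_coef mulr_sumr.
    under eq_bigr => j _ do rewrite !mxE -mulrA mulr_suml mulr_sumr.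
    rewrite exchange_big; apply: eq_bigr => i _ /=.
    rewrite -mulr_sumr; congr (_ * _); under eq_bigr do rewrite -mulrA mulr_algl.
    rewrite -mulr_sumr; congr (_ * _); rewrite -rmorphXn /= -[in RHS](sum_coord (z ^+ i)) linear_sum.
    by apply: eq_bigr => j _; rewrite linearZ.
  rewrite horner_prod; have [->|ne] := eqVneq k k'.
    have wE : \prod_(h | h != enum_val k') ('X - (s h z)%:P).[s (enum_val k') z] = w k'.
      by apply: eq_bigr => h _; rewrite hornerXsubC.
    rewrite wE mulVf //; apply/prodf_neq0 => h ne.
    by rewrite subr_eq0 (inj_eq inj) eq_sym.
  rewrite (bigD1 (enum_val k')) /=; last by rewrite eq_sym (inj_eq enum_val_inj).
  by rewrite hornerXsubC subrr mul0r mulr0.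
have free : row_free M.
  by move: full; rewrite /row_free /row_full => /eqP ->; rewrite -dimL.
have /row_fullP[N NM] := full; have /row_freeP[N' MN] := free.
have NN : N = N' by rewrite -[N]mulmx1 -MN mulmxA NM mul1mx.
rewrite -{}NN in MN.
exists (fun f : {ffun gT -> L} => [ffun j => ((\row_k f (enum_val k)) *m N) 0 j]).
  move=> a; apply/ffunP => j; rewrite ffunE.
  rewrite (_ : \row_k _ = (\row_j a j) *m M) -?mulmxA ?MN ?mulmx1 ?mxE //.
  by apply/rowP => k; rewrite mxE (torsor_map_mx s a) enum_valK.
move=> f; apply/ffunP => g; rewrite (torsor_map_mx s) .
rewrite (_ : \row_j _ = (\row_k f (enum_val k)) *m N) -?mulmxA ?NM ?mulmx1 ?mxE ?enum_rankK //.
by apply/rowP => j; rewrite mxE ffunE.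
Qed.

(** * Equivariant homomorphisms to G-fields *)

Section OverK.
Variables (K : fieldType) (gT : finGroupType) (d : nat).
Variable rG : mx_representation K [set: gT]%G d.
Hypothesis ch0 : [pchar K] =i pred0.
Local Notation A := {mpoly K[d]}.
Local Notation act := (act_poly rG).
Local Notation G := [set: gT]%SET.

(** x is the K-point of V / H below the kernel of phi. *)
Definition encodes (H : {set gT}) (E : fieldType) (phi : {rmorphism A -> E})
    (x : funfield K d -> option K) : Prop :=
  forall f c, x f = Some c <-> invariants rG H f /\ val_at phi f (phi c%:MP).

Section AnyField.
Variables (E : fieldType) (phi : {rmorphism A -> E}).

Lemma pchar_target : [pchar E] =i pred0.
Proof. by move=> p; rewrite (fmorph_pchar (phi \o @mpolyC d K)); apply: ch0. Qed.

Lemma const_inj c c' : phi c%:MP = phi c'%:MP -> c = c'.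
Proof. exact: (fmorph_inj (phi \o @mpolyC d K)). Qed.

Lemma encodes_inj (H : {set gT}) x x' : encodes H phi x -> encodes H phi x' -> x = x'.
Proof.
move=> ex ex'; apply/funext => f; case E1 : (x f) => [c|].
  by move/ex/ex': E1 => ->.
by case E2 : (x' f) => [c|//]; move/ex'/ex: E2; rewrite E1.
Qed.

Lemma encodes_poly (H : {set gT}) x p c : encodes H phi x -> invpoly rG H p ->
  x p%:F = Some c <-> phi p = phi c%:MP.
Proof.
move=> ex inv; rewrite ex; split=> [[_ v]|E']; first exact: (val_at_inj (val_at_poly phi p) v).
by split; [apply/invpolyP|rewrite -E'; apply: val_at_poly].
Qed.

Lemma rat_encodes (H : {set gT}) :
  (forall f e, invariants rG H f -> val_at phi f e -> exists c, e = phi c%:MP) ->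
  exists x, encodes H phi x.
Proof.
move=> rat.
exists (fun f => xget None [set o | exists2 c, o = Some c &
   invariants rG H f /\ val_at phi f (phi c%:MP)]).
move=> f c; split=> [|[inv v]]; case: xgetP => //.
  by move=> o -> [c' -> ?] [<-].
  by move=> o -> [c' -> [_ v']]; congr Some; apply/const_inj/(val_at_inj v' v).
by move/(_ (Some c)) => []; exists c.
Qed.

Lemma encodes_rat_poly (H : {set gT}) P x : kernel_of phi P -> point_at rG H idfun x P ->
  forall p, invpoly rG H p -> exists c, phi p = phi c%:MP.
Proof.
move=> kP pt p inv; have [dom _ _ _] := pt.
have /dom[c xc] : localQ rG H P p%:F.
  apply/(localQ_kernel _ _ _ kP); split; first exact/invpolyP.
  by exists (phi p); apply: val_at_poly.
by exists c; apply/(encodes_poly c (point_atP kP pt) inv).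
Qed.

Lemma free_orbit_form :
  (forall g, (forall p, phi (act g p) = phi p) -> g = 1%g) ->
  exists l, injective (fun g => phi (act g l)).
Proof.
move=> triv; pose J := {u : gT * gT | u.1 != u.2}.
have [[[g h] /= ne]|l hl] := @separating_form K d E J
    (fun u => phi \o act (val u).1) (fun u => phi \o act (val u).2) pchar_target.
  apply: contrapT => /forallNP none; case/eqP: ne; apply/eqP; rewrite eq_mulgV1; apply/eqP.
  apply: triv => p; rewrite act_polyM; pose q := act h^-1%g p.
  rewrite -[in RHS](act_polyKV rG h p) -/q; move: q.
  apply: (@mpoly_rmorph_ext _ _ _ (phi \o act g) (phi \o act h)) => [c|i] /=.
    by rewrite !act_polyC.
  by apply/eqP; apply: contrapT => /negP /none.
exists l => g h E'; apply/eqP; apply: contrapT => /negP ne.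
by have := hl (exist _ (g, h) ne); rewrite /= E' eqxx.
Qed.

End AnyField.

Definition equivariant (L : Gfield K gT) (phi : {rmorphism A -> L}) : Prop :=
  (forall c, phi c%:MP = c%:A) /\ forall g p, phi (act g p) = gf_act L g (phi p).

Section Equivariant.
Variables (L : Gfield K gT) (phi : {rmorphism A -> L}).
Hypothesis eqv : equivariant phi.

Lemma equivariant_val_rat f e : invariants rG G f -> val_at phi f e ->
  exists c, e = phi c%:MP.
Proof.
move=> inv [a [b [b0 Ef ->]]]; have [hc hact] := eqv.
have := inv; rewrite Ef => /(invariants_div rG _ a (rmorph_neq0 b0)) inv'.
have [g|c ->] := torsor_fixed (@gf_torsor _ _ L) (x := phi a / phi b).
  have E' : gf_act L g (phi a) * phi b = phi a * gf_act L g (phi b).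
    by rewrite -!hact -!rmorphM (inv' g (finset.in_setT _)).
  rewrite rmorphM fmorphV; apply/eqP; rewrite eqr_div ?fmorph_eq0 //.
  exact/eqP.
by exists c; rewrite hc.
Qed.

Lemma equivariant_rat_poly p : invpoly rG G p -> exists c, phi p = phi c%:MP.
Proof. by move/invpolyP => inv; apply: (equivariant_val_rat inv); apply: val_at_poly. Qed.

(** The kernel of phi lies above the unramified point x, so that its inertia
    group is trivial. *)
Lemma equivariant_free_form x : mx_faithful rG -> encodes G phi x -> X_ur rG x ->
  exists l, injective (fun g => phi (act g l)).
Proof.
move=> faith ex [_ unr]; apply: free_orbit_form => g.
have [P [pP vP kP]] := kernel_of_ppoint phi.
apply: (inertia_trivial faith kP); apply: (unr P pP).
exact: point_atI kP equivariant_val_rat ex.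
Qed.

Variable l : A.
Hypothesis l_free : injective (fun g => phi (act g l)).

(** G acts on L over K and permutes the phi (g l) transitively, so they are all
    roots of r. *)
Lemma orbit_values_root (r : {poly K}) : root (map_poly (in_alg L) r) (phi l) ->
  r != 0 -> (#|gT| < size r)%N.
Proof.
move=> rl r0; rewrite -(size_map_poly (in_alg L)).
have -> : #|gT| = size [seq phi (act g l) | g <- enum gT] by rewrite size_map -cardE.
apply: max_poly_roots; first by rewrite map_poly_eq0.
  apply/allP => _ /mapP[g _ ->]; rewrite eqv.2; exact: root_over_ahom.
by rewrite map_inj_uniq ?enum_uniq.
Qed.

Lemma equivariant_primitive : <<1; phi l>>%VS = fullv.
Proof.
apply/eqP; rewrite eqEdim subvf dim_Fadjoin dimv1 muln1.
have /polyOver1P[r Er] := minPolyOver 1 (phi l).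
have sz := size_minPoly 1 (phi l).
have : (#|gT| < size r)%N.
  apply: orbit_values_root; first by rewrite -Er root_minPoly.
  rewrite -(map_poly_eq0 (in_alg L)) -Er -size_poly_eq0 sz //.
rewrite -(size_map_poly (in_alg L)) -Er sz ltnS.
by rewrite (torsor_dim (@gf_torsor _ _ L)).
Qed.

Lemma equivariant_surj y : exists p, phi p = y.
Proof. exact: primitive_surj eqv.1 equivariant_primitive y. Qed.

End Equivariant.
End OverK.

(** * Points from G-fields are primitive, and the G-field is unique *)

Section Primitive.
Variables (K : fieldType) (gT : finGroupType) (d : nat).
Variable rG : mx_representation K [set: gT]%G d.
Hypothesis ch0 : [pchar K] =i pred0.
Local Notation A := {mpoly K[d]}.
Local Notation act := (act_poly rG).
Local Notation G := [set: gT]%SET.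
Local Notation equivariant := (equivariant rG).
Local Notation encodes := (encodes rG).

(** Let y be a K-point of V / H above x.  The polynomial prod_g (T - g l)
    becomes s over K at x, and its factor prod_(h in H) (T - h l) becomes a
    polynomial r over K at y.  As r divides s, it has a root phi (g l), hence
    all of them; but its degree is the order of H. *)
Lemma equivariant_not_from_subgroup (L : Gfield K gT) (phi : {rmorphism A -> L}) x l
    (H : {group gT}) y :
  equivariant phi -> encodes G phi x -> injective (fun g => phi (act g l)) ->
  H \proper G -> X_points rG H idfun y -> x = restrict_point rG y -> False.
Proof.
move=> eqv ex inj /proper_card ltHG [P [pP vP pt]] xy.
have [E' [phi' kP]] := point_residue_field pP vP.
have ey : encodes H phi' y := point_atP kP pt.
have [r Er] := invariant_poly_rat (encodes_rat_poly kP pt) (@orbit_poly_inv _ _ _ rG H l).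
have [s [Es Es']] : exists s : {poly K},
    map_poly phi (orbit_poly rG G l) = map_poly (phi \o @mpolyC d K) s /\
    map_poly phi' (orbit_poly rG G l) = map_poly (phi' \o @mpolyC d K) s.
  apply: (invariant_poly_spec _ (orbit_polyG_inv rG l)) => p inv.
  have [c h] := equivariant_rat_poly eqv inv; exists c => //.
  have /(encodes_poly c ex inv) : phi p = phi c%:MP by [].
  rewrite xy /restrict_point asboolT; last exact/invpolyP.
  have inv' : invpoly rG H p by move=> g _; apply: inv; rewrite inE.
  by move/(encodes_poly c ey inv').
have rs : r %| s.
  rewrite -(dvdp_map (phi' \o @mpolyC d K)) -Er -Es' !map_orbit_poly.
  rewrite [X in _ %| X](_ : _ = \prod_(h in H) ('X - (phi' (act h l))%:P) *
     \prod_(h in ~: H) ('X - (phi' (act h l))%:P)); first exact: dvdp_mulr.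
  by rewrite (bigID (mem H)); congr (_ * _); apply: eq_bigl => h; rewrite !inE.
have szr : size r = #|H|.+1.
  rewrite -(size_map_poly (phi' \o @mpolyC d K)) -Er map_orbit_poly.
  by rewrite -big_enum size_prod_XsubC -cardE.
(* Over L, r is the product of some of the linear factors of s. *)
have [mk Emk] : {mk | map_poly (in_alg L) r %= \prod_(i <- mask mk (enum G)) ('X - (phi (act i l))%:P)}.
  apply: dvdp_prod_XsubC; rewrite big_enum /= -(map_orbit_poly rG phi) Es.
  rewrite (@eq_map_poly _ _ (phi \o @mpolyC d K) (in_alg L)) ?dvdp_map // => c.
  exact: eqv.1.
have : size (mask mk (enum G)) = #|H|.
  by have := eqp_size Emk; rewrite size_map_poly szr size_prod_XsubC => -[].
case Em : (mask mk (enum G)) => [|g0 ms] szm.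
  by have := cardG_gt0 H; rewrite -szm.
have rg0 : root (map_poly (in_alg L) r) (phi (act g0 l)).
  by rewrite (eqp_root Emk) Em big_cons rootM root_XsubC eqxx.
have : (#|gT| < size r)%N.
  apply: (orbit_values_root eqv inj); last by rewrite -size_poly_eq0 szr.
  have := root_over_ahom (gf_act L g0^-1%g) rg0.
  by rewrite -eqv.2 act_polyK.
by rewrite szr ltnS leqNgt -cardsT ltHG.
Qed.

Lemma equivariant_X_prim (L : Gfield K gT) (phi : {rmorphism A -> L}) x :
  mx_faithful rG -> equivariant phi -> encodes G phi x -> X_ur rG x -> X_prim rG x.
Proof.
move=> faith eqv ex ux; split=> // H ltH [y py xy].
have [l inj] := equivariant_free_form ch0 eqv faith ex ux.
exact: equivariant_not_from_subgroup eqv ex inj ltH py xy.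
Qed.

(** Sending phi l to phi' l, which is a root of the same irreducible
    polynomial, gives an embedding t0 : L -> L'.  Now t0 o phi and phi' agree
    on invariants, so phi' = t0 o phi o g for some g, and t0 composed with the
    action of g on L has the required properties. *)
Lemma equivariant_unique (L L' : Gfield K gT) (phi : {rmorphism A -> L})
    (phi' : {rmorphism A -> L'}) x l :
  equivariant phi -> equivariant phi' -> encodes G phi x -> encodes G phi' x ->
  injective (fun g => phi (act g l)) ->
  exists2 t : 'AHom(L, L'), forall p, phi' p = t (phi p) &
    forall g u, t (gf_act L g u) = gf_act L' g (t u).
Proof.
move=> eqv eqv' ex ex' inj.
have same p : invpoly rG G p -> exists2 c, phi p = phi c%:MP & phi' p = phi' c%:MP.
  move=> inv; have [c h] := equivariant_rat_poly eqv inv; exists c => //.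
  by apply/(encodes_poly c ex' inv)/(encodes_poly c ex inv).
have [s [Es Es']] := invariant_poly_spec same (orbit_polyG_inv rG l).
have [b rb|t0 ht0] := primitive_ahom (z' := phi' l) (equivariant_primitive eqv inj).
  have sb : s %| b.
    rewrite -(dvdp_map (in_alg L)) -(@eq_map_poly _ _ (phi \o @mpolyC d K)); last exact: eqv.1.
    rewrite -Es map_orbit_poly -big_enum /= -(big_map (fun g => phi (act g l)) predT (fun z => 'X - z%:P)).
    rewrite uniq_roots_dvdp //.
      apply/allP => _ /mapP[g _ ->]; rewrite eqv.2; exact: root_over_ahom.
    by rewrite uniq_rootsE map_inj_uniq ?enum_uniq.
  have : root (map_poly (in_alg L') s) (phi' l).
    rewrite -(@eq_map_poly _ _ (phi' \o @mpolyC d K)); last exact: eqv'.1.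
    by rewrite -Es' orbit_poly_root.
  by move: sb => /dvdpP[q ->] h; rewrite rmorphM rootM h orbT.
have [p inv|g hg] := lies_over_conjugate (phi := t0 \o phi) (phi' := phi') (rG := rG) (pchar_target ch0 phi').
  have [c h h'] := same p inv; rewrite h' /= h eqv.1 eqv'.1.
  by rewrite linearZ /= rmorph1.
exists (t0 \o gf_act L g)%AF => [p|h u].
  by rewrite hg /= comp_lfunE eqv.2.
have [p <-] := equivariant_surj eqv inj u.
by rewrite !comp_lfunE -!eqv.2 -[t0 _]/((t0 \o phi) _) -hg eqv'.2 hg.
Qed.

End Primitive.

(** * The residue field above a K-point of X *)

Lemma minimal_poly_exists (K E : fieldType) (iota : {rmorphism K -> E}) (th : E) (s : {poly K}) :
  s != 0 -> root (map_poly iota s) th ->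
  exists2 Q : {poly K}, irreducible_poly Q &
    forall r, root (map_poly iota r) th <-> Q %| r.
Proof.
move=> s0 rs.
pose has n := `[< exists r : {poly K}, [/\ r != 0, root (map_poly iota r) th & size r = n] >].
have ex : exists n, has n by exists (size s); apply/asboolP; exists s.
case: (ex_minnP ex) => _ /asboolP[Q [Q0 rQ <-]] minQ.
have dvdQ r : root (map_poly iota r) th -> Q %| r.
  move=> rr; rewrite /dvdp -[_ == 0]negbK; apply/negP => m0.
  have : (size Q <= size (r %% Q)%R)%N.
    apply: minQ; apply/asboolP; exists (r %% Q)%R; split=> //.
    move: rr; rewrite {1}(divp_eq r Q) rmorphD rmorphM /= !rootE hornerD hornerM.
    by rewrite (eqP rQ) mulr0 add0r.
  by rewrite leqNgt ltn_modp Q0.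
have szQ : (1 < size Q)%N.
  rewrite ltnNge; apply/negP => /size1_polyC E'; move: rQ Q0.
  by rewrite E' map_polyC rootC fmorph_eq0 polyC_eq0 => ->.
exists Q => [|r]; last first.
  split=> [/dvdQ//|/dvdpP[q ->]]; by rewrite rmorphM rootM rQ orbT.
split=> // q q1 qQ; have /dvdpP[q' E'] := qQ.
rewrite /eqp qQ /=; have := rQ; rewrite E' rmorphM rootM => /orP[/dvdQ|/dvdQ]; last by rewrite -E'.
have q'0 : q' != 0 by apply: contraNneq Q0 => h; rewrite E' h mul0r.
have q0 : q != 0 by apply: contraNneq Q0 => h; rewrite E' h mulr0.
move/(dvdp_leq q'0); rewrite E' size_mul //.
rewrite -[X in (_ <= X)%N]addn0 -subn1 -addnBA ?size_poly_gt0 // leq_add2l leqn0 subn_eq0.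
by rewrite leq_eqVlt (negPf q1) ltnS leqn0 size_poly_eq0 (negPf q0).
Qed.

Lemma irredp_root_dvd (K E : fieldType) (iota : {rmorphism K -> E}) (Q r : {poly K}) z :
  irreducible_poly Q -> root (map_poly iota Q) z -> root (map_poly iota r) z -> Q %| r.
Proof.
move=> [szQ irr] rQ rr.
have Q0 : Q != 0 by rewrite -size_poly_gt0 ltnW.
have rg : root (map_poly iota (gcdp Q r)) z by rewrite gcdp_map root_gcd rQ.
have : gcdp Q r %= Q.
  apply: irr; last exact: dvdp_gcdl.
  apply/eqP => /eqP /size_poly1P[c c0 E']; move: rg.
  by rewrite E' map_polyC rootC fmorph_eq0 (negPf c0).
by move=> /eqp_dvdl <-; apply: dvdp_gcdr.
Qed.

Section Construction.
Variables (K : fieldType) (gT : finGroupType) (d : nat).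
Variable rG : mx_representation K [set: gT]%G d.
Hypothesis ch0 : [pchar K] =i pred0.
Local Notation A := {mpoly K[d]}.
Local Notation act := (act_poly rG).
Local Notation G := [set: gT]%SET.
Local Notation equivariant := (equivariant rG).
Local Notation encodes := (encodes rG).

(** The extension is generated by a root z of the minimal polynomial Q of
    phi l, and embeds in E.  Interpolation at the phi (g l) expresses every
    value of phi as a quotient of two polynomials in phi l over K, so that phi
    takes its values in the image of this embedding. *)
Lemma finite_residue_field (E : fieldType) (phi : {rmorphism A -> E}) l :
  (forall p, invpoly rG G p -> exists c, phi p = phi c%:MP) ->
  injective (fun g => phi (act g l)) ->
  exists (L : fieldExtType K) (phiL : {rmorphism A -> L}) (Q : {poly K}),
    [/\ forall c, phiL c%:MP = c%:A, forall p, phiL p = 0 <-> phi p = 0,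
        forall r, root (map_poly (in_alg L) r) (phiL l) <-> Q %| r,
        \dim {:L} = (size Q).-1 & <<1; phiL l>>%VS = fullv].
Proof.
move=> rat inj; pose iota : {rmorphism K -> E} := phi \o @mpolyC d K.
have [s Es] := invariant_poly_rat rat (orbit_polyG_inv rG l).
have rs : root (map_poly iota s) (phi l) by rewrite /iota -Es orbit_poly_root.
have s0 : s != 0.
  rewrite -(map_poly_eq0 iota) -Es map_orbit_poly -big_enum.
  by rewrite monic_neq0 // monic_prod_XsubC.
have [Q irrQ QP] := minimal_poly_exists s0 rs.
have [L dimL [z rz genz]] := irredp_FAdjoin irrQ.
pose f := horner_eval z \o map_poly (in_alg L).
pose f' := horner_eval (phi l) \o map_poly iota.
have surj := primitive_generates genz.
have [|b fb0|h hf] := @rmorph_factor {poly K} L E f f'; first exact: surj.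
  have rb : root (map_poly (in_alg L) b) z by apply/eqP.
  by apply/eqP/(QP b)/(irredp_root_dvd irrQ rz rb).
have him p : exists u, h u = phi p.
  (* For q = 1 this gives the denominator, which is nonzero. *)
  have lag q : exists u, h u = phi q * \prod_(g | g != 1%g) (phi l - phi (act g l)).
    have [r Er] := invariant_poly_rat rat (lagrange_poly_inv rG l q).
    by exists (f r); rewrite hf -horner_lagrange_poly Er.
  have [u hu] := lag p; have [w hw] := lag 1; exists (u / w).
  rewrite fmorph_div hu hw rmorph1 mul1r mulfK //.
  apply/prodf_neq0 => g g1; rewrite subr_eq0 -[X in phi X](act_poly1 rG l).
  by rewrite (inj_eq inj) eq_sym.
have /choice[u hu] i := him 'X_i.
pose phiL : {rmorphism A -> L} := mmap (in_alg L) u.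
have hC c : h c%:A = phi c%:MP.
  have := hf c%:P; rewrite /f /f' /= /horner_eval !map_polyC !hornerC //.
have hphi p : h (phiL p) = phi p.
  apply: (@mpoly_rmorph_ext _ _ _ (h \o phiL) phi) => [c|i].
    by rewrite /= /phiL mmapC hC.
  by rewrite /= /phiL mmapX mmap1U.
have zE : phiL l = z.
  apply: (fmorph_inj h); rewrite hphi.
  have := hf 'X; rewrite /f /f' /= /horner_eval !map_polyX !hornerX => -> //.
exists L, phiL, Q; rewrite zE; split=> //.
- by move=> c; rewrite /phiL /= mmapC.
- by move=> p; rewrite -hphi; split=> [->|/eqP]; rewrite ?rmorph0 // fmorph_eq0 => /eqP.
move=> r; split; first exact: irredp_root_dvd.
by move=> /dvdpP[q ->]; rewrite rmorphM rootM rz orbT.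
Qed.

End Construction.

(** * The decomposition group of a primitive point *)

Section Decomposition.
Variables (K : fieldType) (gT : finGroupType) (d : nat).
Variable rG : mx_representation K [set: gT]%G d.
Hypothesis ch0 : [pchar K] =i pred0.
Local Notation A := {mpoly K[d]}.
Local Notation act := (act_poly rG).
Local Notation G := [set: gT]%SET.
Local Notation equivariant := (equivariant rG).
Local Notation encodes := (encodes rG).

Variables (L : fieldExtType K) (phi : {rmorphism A -> L}) (l : A) (Q : {poly K}).
Hypothesis phiC : forall c, phi c%:MP = c%:A.
Hypothesis QP : forall r, root (map_poly (in_alg L) r) (phi l) <-> Q %| r.
Hypothesis dimQ : \dim {:L} = (size Q).-1.
Hypothesis gen : <<1; phi l>>%VS = fullv.
Hypothesis l_free : injective (fun g => phi (act g l)).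
Hypothesis rat : forall p, invpoly rG G p -> exists c, phi p = phi c%:MP.

Lemma residue_surj y : exists p, phi p = y.
Proof. exact: primitive_surj phiC gen y. Qed.

Lemma ahom_lift (phi' : {rmorphism A -> L}) : (forall c, phi' c%:MP = c%:A) ->
  (forall p, phi p = 0 -> phi' p = 0) ->
  exists t : 'AEnd(L), forall p, t (phi p) = phi' p.
Proof.
move=> phi'C ker.
exact: (ahom_factor (k := @mpolyC d K) phiC phi'C residue_surj ker).
Qed.

Definition decomposition : {set gT} :=
  [set g | `[< forall p, phi p = 0 -> phi (act g p) = 0 >]].

Lemma decompositionP g :
  reflect (forall p, phi p = 0 -> phi (act g p) = 0) (g \in decomposition).
Proof. by rewrite inE; apply: asboolP. Qed.

Lemma decomposition_group_set : group_set decomposition.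
Proof.
apply/group_setP; split=> [|g h /decompositionP hg /decompositionP hh].
  by apply/decompositionP => p; rewrite act_poly1.
by apply/decompositionP => p p0; rewrite act_polyM; apply/hg/hh.
Qed.

Canonical decomposition_group := Group decomposition_group_set.

Lemma decomposition_ahom g : g \in decomposition ->
  exists t : 'AEnd(L), forall p, t (phi p) = phi (act g p).
Proof.
move=> /decompositionP ker; apply: (ahom_lift (phi' := phi \o act g)) => //= c.
by rewrite act_polyC.
Qed.

(** The automorphism t with t (phi l) = phi (g l) satisfies t o phi = phi o g'
    for some g'; applied to l this gives g = g'. *)
Lemma conjugate_root_ahom g : root (map_poly (in_alg L) Q) (phi (act g l)) ->
  exists t : 'AEnd(L), forall p, t (phi p) = phi (act g p).
Proof.
move=> rg.
have [b /QP/dvdpP[q ->]|t ht] := primitive_ahom (z' := phi (act g l)) gen.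
  by rewrite rmorphM rootM rg orbT.
have [p inv|g' hg'] := lies_over_conjugate (phi := phi) (phi' := t \o phi) (rG := rG)
    (pchar_target ch0 phi).
  by have [c h] := rat inv; rewrite /= h phiC linearZ /= rmorph1.
suff -> : g = g' by exists t.
by apply: l_free; rewrite -hg' /= ht.
Qed.

Lemma orbit_poly_Q : exists2 s : {poly K}, Q %| s &
  map_poly (in_alg L) s = \prod_(g in G) ('X - (phi (act g l))%:P).
Proof.
have [s Es] := invariant_poly_rat rat (orbit_polyG_inv rG l).
have Es' : map_poly phi (orbit_poly rG G l) = map_poly (in_alg L) s.
  by rewrite Es; apply: eq_map_poly => c /=; rewrite phiC.
exists s; last by rewrite -Es' map_orbit_poly.
by apply/QP; rewrite -Es' orbit_poly_root.
Qed.

Lemma size_Q_gt1 : (1 < size Q)%N.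
Proof.
by have := adim_gt0 {:L}; rewrite dimQ; case: (size Q) => [|[]].
Qed.

(** The roots of the minimal polynomial Q of phi l are the phi (g l) for some
    set of g, and each of these g is in the decomposition group because it is
    induced by an automorphism of L.  Write e as r(phi l) with deg r < deg Q.
    All these automorphisms fix e, so r - e vanishes at the deg Q roots of Q:
    r is constant. *)
Lemma decomposition_invariants_rat f e : invariants rG decomposition f ->
  val_at phi f e -> exists c, e = phi c%:MP.
Proof.
move=> inv [a [b [b0 Ef Ee]]].
have := inv; rewrite Ef => /(invariants_div rG _ a (rmorph_neq0 b0)) inv'.
have Q0 : Q != 0 by rewrite -size_poly_gt0 (ltnW size_Q_gt1).
have [r0 Er0] := primitive_generates gen e.
pose r := r0 %% Q.
have Er : (map_poly (in_alg L) r).[phi l] = e.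
  rewrite -Er0 (divp_eq r0 Q) rmorphD rmorphM hornerD hornerM.
  have /eqP -> : root (map_poly (in_alg L) Q) (phi l) by apply/QP.
  by rewrite mulr0 add0r.
have [s Qs Es] := orbit_poly_Q.
have [mk Emk] : {mk | map_poly (in_alg L) Q %= \prod_(i <- mask mk (enum G)) ('X - (phi (act i l))%:P)}.
  by apply: dvdp_prod_XsubC; rewrite big_enum /= -Es dvdp_map.
(* ms lists the g for which phi (g l) is a root of Q. *)
set ms := mask mk (enum G) in Emk.
have szms : size ms = (size Q).-1.
  by have := eqp_size Emk; rewrite size_map_poly size_prod_XsubC => ->.
have fixe g : g \in ms -> (map_poly (in_alg L) r).[phi (act g l)] = e.
  move=> gms; have rg : root (map_poly (in_alg L) Q) (phi (act g l)).
    rewrite (eqp_root Emk) -(big_map (fun g => phi (act g l)) predT (fun z => 'X - z%:P)).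
    rewrite root_prod_XsubC; exact: (map_f (fun g => phi (act g l)) gms).
  have [t ht] := conjugate_root_ahom rg.
  have gD : g \in decomposition.
    by apply/decompositionP => p p0; rewrite -ht p0 rmorph0.
  have te : t e = e.
    rewrite Ee rmorphM fmorphV /= !ht; apply/eqP; rewrite eqr_div //; last first.
      by rewrite -ht fmorph_eq0.
    by rewrite -!rmorphM inv'.
  by rewrite -ht -ahom_horner Er te.
have q0 : map_poly (in_alg L) r - e%:P = 0.
  apply/eqP; apply: contrapT => /negP q0.
  have : (size [seq phi (act g l) | g <- ms] < size (map_poly (in_alg L) r - e%:P)%R)%N.
    apply: max_poly_roots => //.
      by apply/allP => _ /mapP[g gms ->]; rewrite rootE !hornerE fixe // subrr.
    by rewrite map_inj_uniq // mask_uniq // enum_uniq.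
  rewrite size_map szms ltnNge => /negP; apply.
  rewrite (leq_trans (size_polyD _ _)) // size_polyN size_map_poly geq_max.
  apply/andP; split; rewrite -ltnS (prednK (ltnW size_Q_gt1)); first by rewrite ltn_modp.
  exact: leq_ltn_trans (size_polyC_leq1 _) size_Q_gt1.
exists r`_0; rewrite phiC; have := congr1 (fun q : {poly L} => q`_0) q0.
by rewrite coefB coef_map coefC eqxx coef0 => /eqP; rewrite subr_eq0 => /eqP <-.
Qed.

(** Every phi (g l) is then a root of Q, and Q divides prod_g (T - phi (g l)). *)
Lemma decomposition_full_dim : decomposition = G -> \dim {:L} = #|gT|.
Proof.
move=> DG; have Q0 : Q != 0 by rewrite -size_poly_gt0 (ltnW size_Q_gt1).
have [s Qs Es] := orbit_poly_Q.
have s0 : s != 0.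
  rewrite -(map_poly_eq0 (in_alg L)) Es -big_enum.
  by rewrite monic_neq0 // monic_prod_XsubC.
rewrite dimQ; apply/eqP; rewrite eqn_leq; apply/andP; split.
  rewrite -ltnS (prednK (ltnW size_Q_gt1)).
  rewrite (leq_trans (dvdp_leq s0 Qs)) // -(size_map_poly (in_alg L)) Es -big_enum.
  by rewrite size_prod_XsubC -cardE cardsT.
rewrite -ltnS (prednK (ltnW size_Q_gt1)) -(size_map_poly (in_alg L)).
have -> : #|gT| = size [seq phi (act g l) | g <- enum gT] by rewrite size_map -cardE.
apply: max_poly_roots; first by rewrite map_poly_eq0.
  apply/allP => _ /mapP[g _ ->].
  have [|t ht] := @decomposition_ahom g; first by rewrite DG inE.
  by rewrite -ht; apply: root_over_ahom; apply/QP.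
by rewrite map_inj_uniq ?enum_uniq.
Qed.

Lemma decomposition_full_Gfield : decomposition = G ->
  exists (M : Gfield K gT) (phiM : {rmorphism A -> M}), equivariant phiM /\
    forall x, encodes G phi x -> encodes G phiM x.
Proof.
move=> DG.
have /choice[s hs] g : exists t : 'AEnd(L), forall p, t (phi p) = phi (act g p).
  by apply: decomposition_ahom; rewrite DG inE.
have s1 x : s 1%g x = x by have [p <-] := residue_surj x; rewrite hs act_poly1.
have sM g h x : s (g * h)%g x = s g (s h x).
  by have [p <-] := residue_surj x; rewrite !hs act_polyM.
have sep : separable 1 {:L}.
  by apply/separableP => y _; apply: pcharf0_separable; apply: (pchar_target ch0 phi).
have tors : torsor s.
  apply: (torsor_of_distinct (z := phi l)); first exact: decomposition_full_dim.
  by move=> g h; rewrite !hs; apply: l_free.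
by exists (GField s1 sM sep tors), phi; do 2![split=> //].
Qed.

End Decomposition.

(** By [decomposition_invariants_rat] the point x lifts to a K-point of V / D,
    D being the decomposition group; primitivity then says that D = G. *)
Lemma X_prim_from_Gfield (K : fieldType) (gT : finGroupType) d
    (rG : mx_representation K [set: gT]%G d) x :
  [pchar K] =i pred0 -> mx_faithful rG -> X_prim rG x ->
  exists (M : Gfield K gT) (phi : {rmorphism {mpoly K[d]} -> M}),
    equivariant rG phi /\ encodes rG [set: gT]%SET phi x.
Proof.
move=> ch0 faith [[[P [pP vP pt]] unr] prim].
have [E [phi kP]] := point_residue_field pP vP.
have [l inj] : exists l, injective (fun g => phi (act_poly rG g l)).
  apply: (free_orbit_form ch0) => g.
  by apply: (inertia_trivial faith kP); apply: unr.
have rat := encodes_rat_poly kP pt.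
have [L [phiL [Q [phiLC ker QP dimQ gen]]]] := finite_residue_field rat inj.
have kPL : kernel_of phiL P by move=> n a ha; rewrite ker; apply: kP ha.
have injL : injective (fun g => phiL (act_poly rG g l)).
  move=> g h /eqP; rewrite -subr_eq0 -rmorphB => /eqP/ker/eqP.
  by rewrite rmorphB subr_eq0 => /eqP/inj.
have ratL := encodes_rat_poly kPL pt.
have ex : encodes rG [set: gT]%SET phiL x := point_atP kPL pt.
pose D := decomposition_group rG phiL.
have Drat := decomposition_invariants_rat ch0 phiLC QP dimQ gen injL ratL.
have DG : decomposition rG phiL = [set: gT]%SET.
  apply/eqP; apply: contrapT => ne.
  have Dprop : decomposition rG phiL \proper [set: gT]%SET.
    by rewrite finset.properEneq finset.subsetT andbT; apply/negP.
  apply: (prim D Dprop); have [y ey] := rat_encodes Drat.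
  exists y; first by exists P; split=> //; exact: point_atI kPL Drat ey.
  apply: (encodes_inj ex) => f c; rewrite /restrict_point.
  case: asboolP => inv; last by split=> [//|[]].
  rewrite ey; split=> [[_ v]|[_ v]]; split=> //.
  exact: invariantsS (finset.subsetT _) inv.
have [M [phiM [eqv enc]]] := decomposition_full_Gfield ch0 phiLC QP dimQ gen injL ratL DG.
by exists M, phiM; split=> //; apply: enc.
Qed.

(** * Points of untwisted spaces *)

Section UntwistedPoints.
Variables (K : fieldType) (gT : finGroupType) (d : nat).
Variable rG : mx_representation K [set: gT]%G d.
Variable L : Gfield K gT.
Local Notation A := {mpoly K[d]}.
Local Notation act := (act_poly rG).
Local Notation G := [set: gT]%SET.
Local Notation Xi := (Xi rG L).
Local Notation pts := (untwist_points rG L).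
Local Notation b := (vbasis Xi).

Lemma XiP (xi : 'Hom(lforms K d, L)) :
  xi \in Xi <-> forall g f, gf_act L g (xi f) = xi (rG g *m f).
Proof.
have memE g : xi \in lker (linfun (fun xi : 'Hom(lforms K d, L) =>
     (gf_act L g \o xi)%VF - (xi \o linfun (mulmx (rG g)))%VF)) <->
    forall f, gf_act L g (xi f) = xi (rG g *m f).
  set F := fun xi : 'Hom(lforms K d, L) => _.
  have linF : linear F.
    move=> c u v; apply/lfunP => f; rewrite /F.
    rewrite !(add_lfunE, scale_lfunE, opp_lfunE, comp_lfunE) linearP /= scalerBr.
    by rewrite opprD addrACA.
  pose mF := GRing.isLinear.Build _ _ _ _ F linF.
  pose FF : {linear 'Hom(lforms K d, L) -> 'Hom(lforms K d, L)} := HB.pack F mF.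
  rewrite memv_ker (lfunE FF) /= /F; split=> [/eqP E f|E].
    have /lfunP/(_ f) := E; rewrite !(add_lfunE, opp_lfunE, comp_lfunE) lfunE zero_lfunE.
    by move/eqP; rewrite subr_eq0 => /eqP.
  apply/eqP/lfunP => f; rewrite !(add_lfunE, opp_lfunE, comp_lfunE) lfunE zero_lfunE /=.
  by rewrite E subrr.
split=> [h g|h]; first by apply/memE; move: h; rewrite !memvE => /subv_bigcapP/(_ g isT).
by rewrite memvE; apply/subv_bigcapP => g _; rewrite -memvE; apply/memE.
Qed.

(** The element of Xi corresponding to y under the duality between Xi and
    Theta. *)
Definition xi_of (y : pts) : 'Hom(lforms K d, L) :=
  \sum_(j < \dim Xi) (y (theta j) : K) *: b`_j.

Lemma untwistE y f : untwist y f = xi_of y f.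
Proof. by rewrite sum_lfunE; apply: eq_bigr => j _; rewrite scale_lfunE. Qed.

Lemma xi_of_mem y : xi_of y \in Xi.
Proof.
by apply: memv_suml => j _; rewrite memvZ // vbasis_mem // mem_nth // size_tuple.
Qed.

Lemma coord_xi_of y j : coord b j (xi_of y) = y (theta j).
Proof. by rewrite coord_sum_free ?(basis_free (vbasisP _)). Qed.

Lemma thetaE j (v : subvs_of Xi) : theta j v = coord b j (vsval v).
Proof.
pose F (xi : subvs_of Xi) : K^o := coord b j (vsval xi).
have linF : linear F by move=> c u w; rewrite /F !linearP.
pose mF := GRing.isLinear.Build _ _ _ _ F linF.
pose FF : {linear subvs_of Xi -> K^o} := HB.pack F mF.
exact: (lfunE FF).
Qed.

Lemma xi_of_inj : injective xi_of.
Proof.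
move=> y y' E; apply/lfunP => t.
have -> : t = \sum_(j < \dim Xi) (t (vsproj Xi b`_j) : K) *: theta j.
  apply/lfunP => v; rewrite sum_lfunE.
  rewrite -{1}(vsvalK v) (coord_vbasis (subvsP v)) !linear_sum.
  by apply: eq_bigr => j _; rewrite scale_lfunE thetaE !linearZ /= [LHS]mulrC.
rewrite !linear_sum; apply: eq_bigr => j _; rewrite !linearZ /=; congr (_ *: _).
by rewrite -!coord_xi_of E.
Qed.

Lemma xi_of_surj xi : xi \in Xi -> exists y, xi_of y = xi.
Proof.
move=> xiXi; pose F (t : Theta rG L) : K^o := t (vsproj Xi xi).
have linF : linear F by move=> c u w; rewrite /F add_lfunE scale_lfunE.
pose mF := GRing.isLinear.Build _ _ _ _ F linF.
pose FF : {linear Theta rG L -> K^o} := HB.pack F mF.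
exists (linfun FF); rewrite [RHS](coord_vbasis xiXi); apply: eq_bigr => j _.
by rewrite lfunE /= /F thetaE vsprojK.
Qed.

Definition point_hom (y : pts) : {rmorphism A -> L} :=
  mmap (in_alg L) (fun i => untwist y (delta_mx i 0)).

Lemma point_homC y c : point_hom y c%:MP = c%:A.
Proof. by rewrite /point_hom /= mmapC. Qed.

Lemma point_homX y i : point_hom y 'X_i = xi_of y (delta_mx i 0).
Proof. by rewrite /point_hom /= mmapX mmap1U untwistE. Qed.

Lemma cV_sum_delta (v : lforms K d) : v = \sum_i v i 0 *: delta_mx i 0.
Proof.
apply/colP => i; rewrite summxE (bigD1 i) //= big1 => [|k ne]; rewrite !mxE.
  by rewrite !eqxx mulr1 addr0.
by rewrite eq_sym (negPf ne) mulr0.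
Qed.

Lemma point_hom_equivariant y : equivariant rG (point_hom y).
Proof.
split=> [c|g p]; first exact: point_homC.
apply: (@mpoly_rmorph_ext _ _ _ (point_hom y \o act g) (gf_act L g \o point_hom y)) => [c|j] /=.
  by rewrite act_polyC !point_homC linearZ /= rmorph1.
rewrite act_polyX rmorph_sum point_homX; have /XiP -> := xi_of_mem y.
rewrite [X in _ = xi_of y X]cV_sum_delta linear_sum; apply: eq_bigr => i _ /=.
rewrite -mul_mpolyC rmorphM /= point_homC point_homX linearZ /= mulr_algl.
by congr (_ *: _); rewrite -colE mxE.
Qed.

Lemma point_hom_inj y y' : point_hom y =1 point_hom y' -> y = y'.
Proof.
move=> E; apply/xi_of_inj/lfunP => f; rewrite (cV_sum_delta f) !linear_sum.
by apply: eq_bigr => i _; rewrite !linearZ /= -!point_homX E.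
Qed.

Lemma equivariant_point_hom (phi : {rmorphism A -> L}) : equivariant rG phi ->
  exists y, phi =1 point_hom y.
Proof.
move=> [phiC phia]; pose F (f : lforms K d) : L := \sum_i f i 0 *: phi 'X_i.
have linF : linear F.
  move=> c u w; rewrite /F scaler_sumr -big_split /=; apply: eq_bigr => i _.
  by rewrite !mxE scalerDl scalerA.
pose mF := GRing.isLinear.Build _ _ _ _ F linF.
pose FF : {linear lforms K d -> L} := HB.pack F mF.
have [xi xiX] : exists xi : 'Hom(lforms K d, L), forall i, xi (delta_mx i 0) = phi 'X_i.
  exists (linfun FF) => i; rewrite lfunE /= /F (bigD1 i) //= big1 => [|k ne].
    by rewrite mxE !eqxx scale1r addr0.
  by rewrite mxE (negPf ne) scale0r.
have /xi_of_surj[y hy] : xi \in Xi.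
  apply/XiP => g f; rewrite (cV_sum_delta f) mulmx_sumr !linear_sum.
  apply: eq_bigr => j _; rewrite -scalemxAr !linearZ /= xiX; congr (_ *: _).
  rewrite -phia act_polyX rmorph_sum [X in _ = xi X]cV_sum_delta linear_sum.
  apply: eq_bigr => i _; rewrite linearZ /= xiX -mul_mpolyC rmorphM phiC /= mulr_algl.
  by congr (_ *: _); rewrite -colE mxE.
exists y => p; apply: mpoly_rmorph_ext => [c|i]; first by rewrite phiC point_homC.
by rewrite point_homX hy xiX.
Qed.

Lemma pi_L_encodes y : encodes rG G (point_hom y) (pi_L (y, 1)).
Proof.
have evE (p : {mpoly K[d.+1]}) :
    mmap (in_alg L) (untwist_coords (y, 1)) p = point_hom y (dehomog p).
  apply: (@mpoly_rmorph_ext _ _ _ (mmap (in_alg L) (untwist_coords (y, 1)))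
    (point_hom y \o @dehomog K d)) => [c|i] /=.
    by rewrite mmapC dehomogC point_homC.
  rewrite mmapX mmap1U dehomogX /untwist_coords; case: unliftP => [j _|_].
    by rewrite point_homX untwistE.
  by rewrite rmorph1 scale1r.
move=> f c; rewrite /pi_L point_homC; split=> [|[inv [a [q [q0 Ef E]]]]]; case: xgetP => //.
  move=> o -> [c' [n [a [q [-> [ha hq] [inv Ef]]]]]]; rewrite !evE => q0 E [<-].
  by split=> //; exists (dehomog a), (dehomog q).
  move=> o -> [c' [n [a' [q' [-> [ha hq] [_ Ef']]]]]]; rewrite !evE => q'0 E'.
  congr Some; apply: (fmorph_inj (in_alg L)); rewrite /= E E'.
  apply: (val_at_inj (phi := point_hom y) (f := f)).
    by exists (dehomog a'), (dehomog q').
  by exists a, q.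
move/(_ (Some c)) => []; have [n [a' [q' [ha hq Ea Eq]]]] := homogenise2 a q.
by exists c, n, a', q'; rewrite !evE Ea Eq.
Qed.

End UntwistedPoints.

(** * Fibres of the map to X *)

Section Fibres.
Variables (K : fieldType) (gT : finGroupType) (d : nat).
Variable rG : mx_representation K [set: gT]%G d.
Hypothesis ch0 : [pchar K] =i pred0.
Hypothesis faith : mx_faithful rG.
Local Notation A := {mpoly K[d]}.
Local Notation act := (act_poly rG).
Local Notation G := [set: gT]%SET.
Local Notation pi y := (pi_L (y, 1)).

Lemma V_ur_prim (L : Gfield K gT) (y : untwist_points rG L) : V_ur rG L y -> X_prim rG (pi y).
Proof.
exact: (equivariant_X_prim ch0 faith (point_hom_equivariant y) (pi_L_encodes y)).
Qed.

Lemma V_ur_free_form (L : Gfield K gT) (y : untwist_points rG L) : V_ur rG L y ->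
  exists l, injective (fun g => point_hom y (act g l)).
Proof.
exact: (equivariant_free_form ch0 (point_hom_equivariant y) faith (pi_L_encodes y)).
Qed.

Lemma V_ur_iso (L L' : Gfield K gT) (y : untwist_points rG L) (y' : untwist_points rG L') :
  V_ur rG L y -> pi y = pi y' -> Gfield_iso L L'.
Proof.
move=> ur E; have [l inj] := V_ur_free_form ur.
have eqv := point_hom_equivariant y; have eqv' := point_hom_equivariant y'.
have ey' := pi_L_encodes y'; rewrite -E in ey'.
have [t tphi teq] := equivariant_unique ch0 eqv eqv' (pi_L_encodes y) ey' inj.
exists t => //.
have lin0 : lker t == 0%VS by apply: AHom_lker0.
have tl : limg t = fullv.
  apply/eqP; rewrite eqEdim subvf limg_dim_eq ?(eqP lin0) ?capv0 //.
  by rewrite (torsor_dim (@gf_torsor _ _ L)) (torsor_dim (@gf_torsor _ _ L')) /=.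
apply: (Bijective (g := (t^-1)%VF)) => u; first by rewrite lker0_lfunK.
by rewrite limg_lfunVK // tl memvf.
Qed.

(** The conclusion is needed for every G-field isomorphic to the residue field,
    in order to apply it to a given set of representatives. *)
Lemma X_prim_lift x : X_prim rG x -> exists (M : Gfield K gT),
  forall L : Gfield K gT, Gfield_iso M L ->
  exists2 y : untwist_points rG L, V_ur rG L y & pi y = x.
Proof.
move=> px; have [M [phi [eqv ex]]] := X_prim_from_Gfield ch0 faith px.
exists M => L [t [u tK _] teq].
have [phiC phia] := eqv.
have eqvL : equivariant rG (t \o phi : {rmorphism A -> L}).
  split=> [c|g p]; first by rewrite /= phiC linearZ /= rmorph1.
  by rewrite /= phia teq.
have [y hy] := equivariant_point_hom eqvL.
have tphi p : t (phi p) = point_hom y p := hy p.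
have valE f e : val_at phi f e <-> val_at (point_hom y) f (t e).
  split=> [[a [b [b0 -> ->]]]|[a [b [b0 -> E]]]].
    by exists a, b; rewrite -!tphi fmorph_eq0 b0 fmorph_div.
  exists a, b; split=> //; first by rewrite -(fmorph_eq0 t) /= tphi.
  by apply: (fmorph_inj t); rewrite /= E -!tphi fmorph_div.
have exL : encodes rG G (point_hom y) x.
  move=> f c; have tc : t c%:A = c%:A by rewrite linearZ /= rmorph1.
  rewrite point_homC -tc -phiC; split=> [/ex[i v]|[i /valE v]].
    by split=> //; apply/valE.
  by apply/ex.
have E : pi y = x := encodes_inj (pi_L_encodes y) exL.
by exists y => //; rewrite /V_ur /= E; case: px.
Qed.

(** The bijection sends z to phi o z, phi being the homomorphism of y.  For z
    central this is equivariant, and it agrees with phi on invariants.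
    Conversely, if phi o g is equivariant for some g, then phi (g h l) =
    phi (h g l) for all h, hence g h = h g. *)
Lemma fibre_center (L : Gfield K gT) (y : untwist_points rG L) : V_ur rG L y ->
  exists F : gT -> untwist_points rG L,
    set_bij [set` enum 'Z(G)%g] [set y' | V_ur rG L y' /\ pi y' = pi y] F.
Proof.
move=> ur; have [l inj] := V_ur_free_form ur.
have [phiC phia] := point_hom_equivariant y; set phi := point_hom y in phiC phia inj.
have ex : encodes rG G phi (pi y) := pi_L_encodes y.
have cent z g : z \in 'Z(G)%g -> (z * g = g * z)%g.
  by move/centerP => [_ /(_ g)]; apply; rewrite inE.
have /choice[F hF] (z : gT) : exists y' : untwist_points rG L, z \in 'Z(G)%g ->
    forall p, point_hom y' p = phi (act z p).
  have [zZ|] := boolP (z \in 'Z(G)%g); last by exists 0.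
  have [|y' hy'] := equivariant_point_hom (L := L) (phi := phi \o act z) (rG := rG).
    split=> [c|g p] /=; first by rewrite act_polyC phiC.
    by rewrite -act_polyM cent // act_polyM phia.
  by exists y' => _ p; rewrite -hy'.
have piF z : z \in 'Z(G)%g -> pi (F z) = pi y.
  move=> zZ; apply: (encodes_inj (pi_L_encodes (F z))) => f c.
  rewrite ex !point_homC.
  have valE : invariants rG G f -> val_at phi f c%:A <-> val_at (point_hom (F z)) f c%:A.
    move=> inv; split=> [[a [b [b0 Ef ->]]]|[a [b [b0 Ef ->]]]].
      have b'0 : phi (act z b) != 0 by rewrite phia fmorph_eq0.
      exists a, b; rewrite !(hF z zZ); split=> //; apply/eqP.
      have := inv; rewrite Ef => /(invariants_div rG _ a (rmorph_neq0 b0))/(_ z (finset.in_setT _)) E.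
      by rewrite eqr_div // -!rmorphM E.
    rewrite !(hF z zZ) in b0 *; exists (act z a), (act z b); split=> //.
    have nb : b != 0 by rewrite -(act_poly_eq0 rG z) (rmorph_neq0 b0).
    rewrite Ef; apply/frac_eqP; rewrite ?act_poly_eq0 //.
    by have := inv; rewrite Ef => /(invariants_div rG _ a nb)/(_ z (finset.in_setT _)) ->.
  by split=> -[inv v]; split=> //; apply/valE.
exists F; split=> [z /=|z z' |y' /= [ur' E]].
- rewrite mem_enum => zZ; split; last exact: piF.
  by rewrite /V_ur /= piF.
- rewrite !inE /= !mem_enum => zZ z'Z E; apply: inj => /=.
  by rewrite -(hF z zZ) -(hF z' z'Z) E.
have eqv' := point_hom_equivariant y'; have ey' := pi_L_encodes y'; rewrite E in ey'.
have [p inv|g hg] := lies_over_conjugate (phi := phi) (phi' := point_hom y') (rG := rG)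
    (pchar_target ch0 phi).
  have [c h] := equivariant_rat_poly (point_hom_equivariant y) inv.
  rewrite /phi h; have /(encodes_poly c ex inv)/(encodes_poly c ey' inv) -> := h.
  by rewrite !point_homC.
have gZ : g \in 'Z(G)%g.
  apply/centerP; split=> [|h _]; first by rewrite inE.
  apply: inj; change (phi (act (g * h)%g l) = phi (act (h * g)%g l)).
  by rewrite act_polyM -hg eqv'.2 hg -phia -act_polyM.
exists g; first by rewrite /= mem_enum.
by apply: point_hom_inj => p; rewrite (hF g gZ) hg.
Qed.

End Fibres.

(** * Summation along the fibres *)

Section Sums.
Local Open Scope ereal_scope.

(** When all nonempty fibres of the maps p i are in bijection with Zs, and each
    point of X is hit for exactly one i, both sides sum over triples of a point
    x of X, the index i of x, and a point of the fibre of p i at x. *)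
Lemma esum_fibres (R : realType) (T I Z : choiceType) (Y : I -> choiceType)
    (p : forall i, Y i -> T) (U : forall i, set (Y i)) (X : set T) (Zs : set Z)
    (a : T -> \bar R) :
  (forall x, 0 <= a x) ->
  (forall i y, U i y -> X (p i y)) ->
  (forall x, X x -> exists i, exists2 y, U i y & p i y = x) ->
  (forall i j y y', U i y -> U j y' -> p i y = p j y' -> i = j) ->
  (forall i y, U i y -> exists F : Z -> Y i,
     set_bij Zs [set y' | U i y' /\ p i y' = p i y] F) ->
  \esum_(i in [set: I]) \esum_(y in U i) a (p i y) =
  \esum_(x in X) \esum_(z in Zs) a x.
Proof.
move=> a0 UX lift uniq fib.
have inner i : \esum_(y in U i) a (p i y) =
    \esum_(x in p i @` U i) \esum_(z in Zs) a x.
  rewrite esum_esum //.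
  have [->|/set0P[y0 Uy0]] := eqVneq (U i) set0.
    rewrite esum_set0 image_set0.
    by rewrite (_ : _ `*`` _ = set0) ?esum_set0 //; apply/seteqP; split=> // -[x z] [].
  (* Outside the image of U i, the value of F is arbitrary. *)
  have /choice[F hF] x : exists F : Z -> Y i, (p i @` U i) x ->
      set_bij Zs [set y' | U i y' /\ p i y' = x] F.
    have [[y Uy <-]|n] := pselect ((p i @` U i) x); last by exists (fun=> y0).
    by have [F hF] := fib i y Uy; exists F.
  rewrite (reindex_esum ((p i @` U i) `*`` (fun=> Zs)) (U i) (fun k => F k.1 k.2)).
    apply: eq_esum => -[x z] /= [Ux Zz]; have [+ _ _] := hF x Ux.
    by move=> /(_ z Zz)[_ ->].
  split=> [[x z] /= [Ux Zz]|[x z] [x' z']|y Uy /=].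
  - by have [+ _ _] := hF x Ux; move=> /(_ z Zz)[].
  - rewrite !inE /= => -[Ux Zz] [Ux' Zz'] E.
    have [h1 h2 _] := hF x Ux; have [h1' _ _] := hF x' Ux'.
    have xx' : x = x' by have [_ <-] := h1 z Zz; have [_ <-] := h1' z' Zz'; rewrite E.
    by move: E; rewrite -xx' => /h2 -> //; rewrite inE.
  have Uxy : (p i @` U i) (p i y) by exists y.
  have [_ _ h3] := hF _ Uxy; have [z Zz E] := h3 y (conj Uy erefl).
  by exists (p i y, z).
transitivity (\esum_(i in [set: I]) \esum_(x in p i @` U i) \esum_(z in Zs) a x).
  by apply: eq_esum => i _; apply: inner.
rewrite esum_esum => [|i x _ _]; last exact: esum_ge0.
symmetry; apply: reindex_esum; split=> [[i x] /= [_ [y Uy <-]]|[i x] [j x']|x Xx /=].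
- exact: UX.
- rewrite !inE /= => -[_ [y Uy Ey]] [_ [y' Uy' Ey']] E; congr pair => //.
  by apply: (uniq _ _ y y') => //; rewrite Ey Ey'.
by have [i [y Uy E]] := lift x Xx; exists (i, x) => //=; split=> //; exists y.
Qed.

Lemma esum_const_card (R : realType) (T : choiceType) (Z : finType) (B : {set Z})
    (X : set T) (a : T -> \bar R) : (forall x, 0 <= a x) ->
  \esum_(x in X) \esum_(z in [set` enum B]) a x = #|B|%:R%:E * \esum_(x in X) a x.
Proof.
move=> a0; transitivity (\esum_(x in X) \sum_(z <- enum B) a x).
  by apply: eq_esum => x _; rewrite esum_fset // -fsbig_seq ?enum_uniq.
rewrite esum_sum // big_const_seq count_predT -cardE mule_natl.
by rewrite iter_addr_0.
Qed.

End Sums.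

Lemma pchar_number_field (K : fieldExtType rat) : [pchar K] =i pred0.
Proof. by move=> p; rewrite pchar_lalg pchar_num. Qed.

(** The set W selects the points of given height, for the coefficients, or
    everything, for the values. *)
Lemma esum_X_prim (R : realType) (K : fieldType) (gT : finGroupType) d
    (rG : mx_representation K [set: gT]%G d)
    (GFie : choiceType) (L : GFie -> Gfield K gT)
    (W : set (funfield K d -> option K)) (a : (funfield K d -> option K) -> \bar R) :
  [pchar K] =i pred0 -> mx_faithful rG -> enumerates_GFie L ->
  (forall x, (0 <= a x)%E) ->
  (\esum_(i in [set: GFie])
     \esum_(y in V_ur rG (L i) `&` [set y | W (pi_L (y, 1%R))]) a (pi_L (y, 1%R)) =
   #|'Z([set: gT]%SET)%g|%:R%:E * \esum_(x in X_prim rG `&` W) a x)%E.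
Proof.
move=> ch0 faith LG a0.
pose Z := 'Z([set: gT]%SET)%g.
rewrite (@esum_fibres _ _ _ gT (fun i => untwist_points rG (L i)) (fun i y => pi_L (y, 1%R))
  (fun i => V_ur rG (L i) `&` [set y | W (pi_L (y, 1%R))]) (X_prim rG `&` W) [set` enum Z] a) //.
- exact: esum_const_card.
- by move=> i y [ur Wy]; split=> //; apply: V_ur_prim.
- move=> x [px Wx]; have [M lift] := X_prim_lift ch0 faith px.
  have [i [Mi _]] := LG M; exists i; have [y ur E] := lift _ Mi.
  by exists y => //; split=> //=; rewrite E.
- move=> i j y y' [ur _] [ur' _] E.
  have [k [_ kP]] := LG (L i).
  apply: etrans (esym (kP i _)) (kP j _); first exact: (V_ur_iso ch0 faith ur erefl).
  exact: (V_ur_iso ch0 faith ur E).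
move=> i y [ur Wy]; have [F hF] := fibre_center ch0 faith ur; exists F.
move: hF; congr (set_bij _ _ F); apply/seteqP; split=> y' /= => [[ur' E]|[[ur' _] E]] //.
by split=> //; split=> //=; rewrite E.
Qed.

Theorem proposition10p4 (R : realType) (K : fieldExtType rat)
    (gT : finGroupType) (d : nat) (rG : mx_representation K [set: gT]%G d)
    (rG_faithful : mx_faithful rG)
    (etale1 : etale_in_codim1 rG)
    (Kv : forall v : place R K, completion v)
    (m : adelic_metric rG Kv)
    (GFie : choiceType) (L : GFie -> Gfield K gT) (L_GFie : enumerates_GFie L) :
  let H := height m in
  let HL (i : GFie) (y : untwist_points rG (L i)) : R := H (pi_L (y, 1)) in
  let invZ : \bar R := ((#|'Z([set: gT]%SET)%g|%:R)^-1)%:E in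
  (forall h : R,
     dirichlet_coef H (X_prim rG) h =
     (invZ * \esum_(i in [set: GFie])
               dirichlet_coef (@HL i) (V_ur rG (L i)) h)%E)
  /\
  (forall s : R,
     dirichlet_value H (X_prim rG) s =
     (invZ * \esum_(i in [set: GFie])
               dirichlet_value (@HL i) (V_ur rG (L i)) s)%E).
Proof.
move=> H HL invZ.
have ch0 := pchar_number_field K.
have ZP : (0 < #|'Z([set: gT]%SET)%g|)%N by apply: cardG_gt0.
have main W a (a0 : forall x, (0 <= a x)%E) :
  (\esum_(x in X_prim rG `&` W) a x = invZ * \esum_(i in [set: GFie])
     \esum_(y in V_ur rG (L i) `&` [set y | W (pi_L (y, 1%R))]) a (pi_L (y, 1%R)))%E.
  rewrite esum_X_prim // muleA /invZ -EFinM mulVf ?mul1e //.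
  by rewrite pnatr_eq0 -lt0n.
split=> [h|s]; first by rewrite /dirichlet_coef (main _ (fun=> 1%E)).
rewrite /dirichlet_value -[X in esum X _]setIT main => [|x].
  by congr (_ * _)%E; apply: eq_esum => i _; rewrite -[X in _ = esum X _]setIT.
by rewrite lee_fin powR_ge0.
Qed.
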